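(* Let $\Bbbk$ be a field, $S=\Bbbk[x_1,\ldots,x_n]$, and let $\mathfrak{a}=\mathfrak{f}+(G)\subseteq S$ be an almost complete intersection of degrees $(\mathbf{d};D)=(d_1,\ldots,d_h;D)$ with $D<\sigma=\sum_{i=1}^h(d_i-1)$. Let $\tau_-=\lfloor\frac{\sigma+D-1}{2}\rfloor$ and $\tau^+=\lceil\frac{\sigma+D-1}{2}\rceil$. Then $\operatorname{e}(S/\mathfrak{a})\le\prod_{i=1}^h d_i-\sum_{m=D+1}^{\tau_-}\varphi_m-\sum_{m=D+1}^{\tau^+}\varphi_m-2.$
   Context: $\operatorname{HF}(M;j)=\dim_\Bbbk M_j$; $\operatorname{e}$ is multiplicity. An almost complete intersection of degrees $(\mathbf{d};D)=(d_1,\ldots,d_h;D)$ is a homogeneous ideal $\mathfrak{a}$ of height $h$ with $\mathfrak{a}=\mathfrak{f}+(G)$, $\mathfrak{f}$ generated by a homogeneous regular sequence of degrees $d_1\le\cdots\le d_h$, $G$ homogeneous of degree $D$, $G\notin\mathfrak{f}$. In $\overline{S}=\Bbbk[x_1,\ldots,x_h]$ let $(\mathsf{x}^{\mathbf{d}})=(x_1^{d_1},\ldots,x_h^{d_h})$; for $E\le\sigma$ let $U_E$ be the lex-largest monomial ($x_1>\cdots>x_h$) of degree $E$ not in $(\mathsf{x}^{\mathbf{d}})$ and $\mathcal{L}(\mathbf{d};E)=(\mathsf{x}^{\mathbf{d}})+(U_E)$. Define $\varphi_m=\operatorname{HF}(\overline{S}/(\mathsf{x}^{\mathbf{d}});m)-\operatorname{HF}(\overline{S}/\mathcal{L}(\mathbf{d};m-1);m)$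 for $2\le m\le\sigma$ and $\varphi_m=0$ otherwise. Empty sums are $0$. *)

(* Defs.v *)
From HB Require Import structures.
From mathcomp Require Import all_boot all_order all_algebra.
From mathcomp Require Import mpoly.
From Stdlib Require Import ClassicalDescription ClassicalEpsilon.

Set Implicit Arguments.
Unset Strict Implicit.
Unset Printing Implicit Defensive.

Import Order.TTheory GRing.Theory.
Local Open Scope ring_scope.

Definition pb (P : Prop) : bool :=
  if excluded_middle_informative P then true else false.

Section Ideals.
Variables (n : nat) (R : fieldType).
Notation S := {mpoly R[n]}.

Definition is_ideal (I : S -> Prop) : Prop :=
  [/\ I 0, (forall p q, I p -> I q -> I (p + q)) &
      (forall p q, I q -> I (p * q))].

Definition gen_ideal (gs : seq S) : S -> Prop :=
  fun p => exists qs : seq S, size qs = size gs /\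
             p = \sum_(i < size gs) qs`_i * gs`_i.

Definition prime_ideal (P : S -> Prop) : Prop :=
  [/\ is_ideal P, ~ P 1 & forall a b, P (a * b) -> P a \/ P b].

Definition strict_sub (I J : S -> Prop) : Prop :=
  (forall p, I p -> J p) /\ exists p, J p /\ ~ I p.

Definition height_ge (P : S -> Prop) (k : nat) : Prop :=
  exists c : seq (S -> Prop),
    [/\ size c = k.+1, (forall i, (i < k.+1)%N -> prime_ideal (nth P c i)),
        (forall i, (i < k)%N -> strict_sub (nth P c i) (nth P c i.+1)) &
        last P c = P].

Definition height_eq (I : S -> Prop) (h : nat) : Prop :=
  (forall P, prime_ideal P -> (forall p, I p -> P p) -> height_ge P h) /\
  (exists P, [/\ prime_ideal P, (forall p, I p -> P p) & ~ height_ge P h.+1]).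

Definition homog_regular_seq (fs : seq S) (ds : seq nat) : Prop :=
  [/\ size fs = size ds,
      (forall i, (i < size fs)%N -> fs`_i \is (nth 0%N ds i).-homog),
      (forall i, (i < size fs)%N -> forall p,
          gen_ideal (take i fs) (p * fs`_i) -> gen_ideal (take i fs) p) &
      ~ gen_ideal fs 1].

Definition lin_indep_mod (I : S -> Prop) (s : seq S) : Prop :=
  forall c : seq R, size c = size s ->
    I (\sum_(i < size s) c`_i *: s`_i) -> forall i, c`_i = 0.

Definition indep_forms (I : S -> Prop) (j m : nat) : Prop :=
  exists s : seq S, [/\ size s = m, all (fun p => p \is j.-homog) s &
                        lin_indep_mod I s].

(* HF(S/I; j) = dim_k (S/I)_j, as the maximal number of degree-j forms that
   are linearly independent modulo I ((j+1)^n bounds the number of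
   monomials of degree j, hence this dimension). *)
Definition HF (I : S -> Prop) (j : nat) : nat :=
  \max_(m < ((j.+1) ^ n).+1 | pb (indep_forms I j m)) m.

Definition cum_hilbert_poly (I : S -> Prop) (P : {poly rat}) : Prop :=
  exists j0 : nat, forall j : nat, (j0 <= j)%N ->
    ((\sum_(i < j.+1) HF I i)%:R : rat) = P.[j%:R].

Definition mult_of_poly (P : {poly rat}) : rat :=
  ((size P).-1)`!%:R * lead_coef P.

End Ideals.

Definition aci (n : nat) (R : fieldType) (ds : seq nat) (D : nat)
    (fs : seq {mpoly R[n]}) (G : {mpoly R[n]}) : Prop :=
  [/\ homog_regular_seq fs ds, sorted leq ds,
      G \is D.-homog, ~ gen_ideal fs G &
      height_eq (gen_ideal (rcons fs G)) (size ds)].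

Definition sigma (ds : seq nat) : nat := \sum_(d <- ds) (d - 1).

Section Lex.
Variables (R : fieldType) (ds : seq nat).
Local Notation h := (size ds).
Notation Sb := {mpoly R[h]}.

Definition xd_gens : seq Sb := [seq 'X_i ^+ (nth 0%N ds i) | i <- enum 'I_h].

Definition lex_lt (u v : 'X_{1..h}) : Prop :=
  exists i : 'I_h, (forall k : 'I_h, (k < i)%N -> u k = v k) /\ (u i < v i)%N.

Definition std_mon (E : nat) (u : 'X_{1..h}) : Prop :=
  mdeg u = E /\ ~ gen_ideal xd_gens ('X_[u] : Sb).

Definition is_UE (E : nat) (u : 'X_{1..h}) : Prop :=
  std_mon E u /\ forall v, std_mon E v -> v = u \/ lex_lt v u.

Definition U_E (E : nat) : 'X_{1..h} :=
  epsilon (inhabits 0%MM) (is_UE E).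

Definition Lid (E : nat) : Sb -> Prop :=
  gen_ideal (rcons xd_gens ('X_[U_E E])).

Definition phi (m : nat) : int :=
  if (2 <= m <= sigma ds)%N
  then (HF (gen_ideal xd_gens) m)%:Z - (HF (Lid m.-1) m)%:Z
  else 0.

End Lex.

(* Main.v *)
(** Put J = (f : G), M = G S/f and r = n - h.  Multiplicities add up in
    0 -> S/J(-D) -> S/f -> S/a -> 0, and e(S/f) is the product of the degrees,
    so the claim is a lower bound for the growth of the Hilbert function of S/J.

    If n = h, then S/f is Gorenstein with socle degree sigma, which makes the
    Hilbert function of S/J symmetric about (sigma - D)/2; its end values give
    the 2, and each half is estimated from below as follows.  A form F outside
    f, of degree e and killed modulo f by w independent linear forms, is a
    Koszul cycle; since Tor_w(S/(l_1,...,l_w), S/f) lives in degrees at least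
    d_1 + ... + d_w, one has e + w >= d_1 + ... + d_w.  So F S_1 has dimension
    at least h - w modulo f for the largest w allowed by e, and this number
    dominates phi_(e+1).

    If n > h, adjoin a transcendental t; by McCoy's argument the linear form
    l = sum t^i x_i is a nonzerodivisor modulo f.  Writing G = l^k G' modulo f
    with G' outside (f, l) changes neither J nor the estimate, and
    HF(S/(f : G')) is at least the partial sum of HF(S/((f, l) : G')), so
    induction on r applies.

    The height hypothesis only serves to show that G is a zero divisor modulo f
    (a prime containing a regular sequence of length h + 1 has height at least
    h + 1); this gives the Hilbert polynomial of S/a the degree r. *)

Require Import Defs.
From HB Require Import structures.
From mathcomp Require Import all_boot all_order all_algebra.
From mathcomp Require Import mpoly.
From Stdlib Require Import ClassicalDescription ClassicalEpsilon.
From mathcomp Require Import ring lra zify.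
From mathcomp Require classical_sets.

Set Implicit Arguments.
Unset Strict Implicit.
Unset Printing Implicit Defensive.

Import Order.TTheory GRing.Theory Num.Theory.
Local Open Scope ring_scope.

(** * Ideals *)

Section IdealLemmas.
Variables (n : nat) (R : fieldType).
Notation S := {mpoly R[n]}.
Implicit Types (I J : S -> Prop) (p q g : S) (gs : seq S).

Lemma ideal0 I : is_ideal I -> I 0. Proof. by case. Qed.
Lemma idealD I p q : is_ideal I -> I p -> I q -> I (p + q).
Proof. by case=> _ h _; apply: h. Qed.
Lemma idealM I p q : is_ideal I -> I q -> I (p * q).
Proof. by case=> _ _; apply. Qed.
Lemma ideal_mulr I p q : is_ideal I -> I p -> I (p * q).
Proof. by move=> hI Ip; rewrite mulrC; apply: idealM. Qed.
Lemma idealN I p : is_ideal I -> I p -> I (- p).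
Proof. by move=> hI Ip; rewrite -mulN1r; apply: idealM. Qed.
Lemma idealB I p q : is_ideal I -> I p -> I q -> I (p - q).
Proof. by move=> hI Ip Iq; apply: idealD => //; apply: idealN. Qed.
Lemma idealZ I c p : is_ideal I -> I p -> I (c *: p).
Proof. by move=> hI Ip; rewrite -mul_mpolyC; apply: idealM. Qed.
Lemma ideal_sum I (T : Type) (r : seq T) (P : pred T) (F : T -> S) :
  is_ideal I -> (forall i, P i -> I (F i)) -> I (\sum_(i <- r | P i) F i).
Proof.
move=> hI IF; apply: big_ind => //; [exact: ideal0 | by move=> *; apply: idealD].
Qed.
Lemma ideal_eq I p q : is_ideal I -> I (p - q) -> I q -> I p.
Proof. by move=> hI Ipq Iq; rewrite -(subrK q p); apply: idealD. Qed.

Lemma gen_idealP gs p :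
  gen_ideal gs p <-> exists c : nat -> S, p = \sum_(i < size gs) c i * gs`_i.
Proof.
split=> [[qs [sqs ->]]|[c ->]]; first by exists (nth 0 qs).
exists (mkseq c (size gs)); rewrite size_mkseq; split=> //.
by apply: eq_bigr => i _; rewrite nth_mkseq.
Qed.

Lemma gen_is_ideal gs : is_ideal (gen_ideal gs).
Proof.
split.
- by apply/gen_idealP; exists (fun=> 0); rewrite big1 // => i _; rewrite mul0r.
- move=> p q /gen_idealP[c ->] /gen_idealP[d ->]; apply/gen_idealP.
  exists (fun i => c i + d i); rewrite -big_split /=.
  by apply: eq_bigr => i _; rewrite mulrDl.
- move=> p q /gen_idealP[c ->]; apply/gen_idealP; exists (fun i => p * c i).
  by rewrite mulr_sumr; apply: eq_bigr => i _; rewrite mulrA.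
Qed.
Hint Resolve gen_is_ideal : core.

Lemma gen_nil p : gen_ideal [::] p <-> p = 0.
Proof.
split=> [/gen_idealP[c ->]|->]; first by rewrite big_ord0.
exact: ideal0.
Qed.

Lemma gen_rcons gs g p :
  gen_ideal (rcons gs g) p <-> exists a, gen_ideal gs (p - a * g).
Proof.
split=> [/gen_idealP[c ->]|[a /gen_idealP[c pE]]].
  exists (c (size gs)); apply/gen_idealP; exists c.
  rewrite size_rcons big_ord_recr /= nth_rcons ltnn eqxx addrK.
  by apply: eq_bigr => i _; rewrite nth_rcons ltn_ord.
apply/gen_idealP; exists (fun i => if i == size gs then a else c i).
rewrite size_rcons big_ord_recr /= nth_rcons ltnn !eqxx -(subrK (a * g) p) pE.
congr (_ + _); apply: eq_bigr => i _.
by rewrite nth_rcons ltn_ord (ltn_eqF (ltn_ord i)).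
Qed.

Lemma gen_mem gs i : (i < size gs)%N -> gen_ideal gs gs`_i.
Proof.
move=> lti; apply/gen_idealP; exists (fun k => (k == i)%:R).
rewrite (bigD1 (Ordinal lti)) //= eqxx mul1r big1 ?addr0 // => k /negbTE.
by rewrite -val_eqE /= => ->; rewrite mul0r.
Qed.

Lemma gen_in gs g : g \in gs -> gen_ideal gs g.
Proof. by move=> gin; rewrite -(nth_index 0 gin); apply: gen_mem; rewrite index_mem. Qed.

Lemma gen_sub gs I p : is_ideal I -> (forall i, (i < size gs)%N -> I gs`_i) ->
  gen_ideal gs p -> I p.
Proof.
move=> hI Igs /gen_idealP[c ->]; apply: ideal_sum => // i _.
by apply: idealM => //; apply: Igs.
Qed.

Lemma gen_incl gs gs' p : {subset gs <= gs'} -> gen_ideal gs p -> gen_ideal gs' p.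
Proof.
move=> sub; apply: gen_sub => // i lti; apply/gen_in/sub/mem_nth => //.
Qed.

Lemma gen_cons gs g p :
  gen_ideal (g :: gs) p <-> exists a, gen_ideal gs (p - a * g).
Proof.
rewrite -gen_rcons; split; apply: gen_incl => x; by rewrite mem_rcons.
Qed.

Lemma gen_rcons_sub gs g p : gen_ideal gs p -> gen_ideal (rcons gs g) p.
Proof. by apply: gen_incl => x; rewrite mem_rcons inE => ->; rewrite orbT. Qed.

Definition colon I g : S -> Prop := fun p => I (p * g).

Lemma colon_is_ideal I g : is_ideal I -> is_ideal (colon I g).
Proof.
rewrite /colon => hI; split; first by rewrite mul0r; exact: ideal0.
  by move=> p q Ip Iq; rewrite mulrDl; apply: idealD.
by move=> p q Iq; rewrite -mulrA; apply: idealM.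
Qed.

Definition nzd_mod I g := forall p, I (p * g) -> I p.

Definition homog_ideal I := forall p d, I p -> I (pihomog mdeg d p).

(** The component of p in degree i lands in degree i + e, so only i = d contributes. *)
Lemma pihomogMr p q d e : q \is e.-homog ->
  pihomog mdeg (d + e)%N (p * q) = pihomog mdeg d p * q.
Proof.
move=> hq.
pose k := maxn (msize p) d; have hk : (msize p <= k)%N by rewrite leq_maxl.
rewrite {1}(pihomog_partitionE (hk : mmeasure mdeg p <= k)%N).
rewrite mulr_suml raddf_sum /=.
have [ltd|led] := ltnP d k; last first.
  rewrite big1 => [|i _]; last first.
    apply: (pihomog_ne0 (d := (i + e)%N)); last by apply: dhomogM => //; apply: pihomogP.
    by rewrite eqn_add2r; move: (ltn_ord i); case: ltngtP (leq_trans (ltn_ord i) led).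
  rewrite pihomogE big_seq_cond big_pred0 ?mul0r // => m.
  apply/negbTE/negP => /andP[/msize_mdeg_lt lt /eqP E].
  by have:= leq_trans lt hk; rewrite E ltnNge led.
rewrite (bigD1 (Ordinal ltd)) //= big1 => [|i ne]; last first.
  apply: (pihomog_ne0 (d := (i + e)%N)); last by apply: dhomogM => //; apply: pihomogP.
  by rewrite eqn_add2r.
by rewrite addr0 pihomog_dE //; apply: dhomogM => //; apply: pihomogP.
Qed.

Lemma pihomogMr_small p q d e : q \is e.-homog -> (d < e)%N ->
  pihomog mdeg d (p * q) = 0.
Proof.
move=> hq lt.
rewrite {1}(pihomog_partitionE (leqnn (mmeasure mdeg p))).
rewrite mulr_suml raddf_sum /= big1 // => i _.
apply: (pihomog_ne0 (d := (i + e)%N)); last by apply: dhomogM => //; apply: pihomogP.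
by apply/eqP; lia.
Qed.

Lemma gen_homog gs : (forall i, (i < size gs)%N -> exists d, gs`_i \is d.-homog) ->
  homog_ideal (gen_ideal gs).
Proof.
move=> hgs p d /gen_idealP[c ->]; rewrite raddf_sum /=; apply: ideal_sum => // i _.
have [e he] := hgs i (ltn_ord i).
have [lt|le] := ltnP d e; first by rewrite (pihomogMr_small _ he lt); apply: ideal0.
rewrite -(subnK le) pihomogMr //; apply: idealM => //; exact: gen_mem.
Qed.

Lemma colon_homog I g d : homog_ideal I -> g \is d.-homog -> homog_ideal (colon I g).
Proof. by move=> hI hg p e Ip; rewrite /colon -(pihomogMr _ _ hg); apply: hI. Qed.

Lemma homog_ideal_comp I p : is_ideal I -> (forall d, I (pihomog mdeg d p)) -> I p.
Proof.
move=> hI Ip; rewrite (pihomog_partitionE (leqnn (mmeasure mdeg p))).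
exact: ideal_sum.
Qed.

Lemma not_ideal_comp I p : is_ideal I -> ~ I p -> exists d, ~ I (pihomog mdeg d p).
Proof.
move=> hI nIp; case: (classic (exists d, ~ I (pihomog mdeg d p))) => // h.
case: nIp; apply: homog_ideal_comp => // d; apply: Classical_Prop.NNPP => hd.
by apply: h; exists d.
Qed.

End IdealLemmas.
#[export] Hint Resolve gen_is_ideal : core.

(** * Hilbert functions *)

Lemma fun_choice (A B : Type) (P : A -> B -> Prop) :
  (forall a, exists b, P a b) -> exists f, forall a, P a (f a).
Proof.
by move=> h; exists (fun a => proj1_sig (constructive_indefinite_description _ (h a)))
  => a; case: constructive_indefinite_description.
Qed.

Lemma fun_choice_nat (B : Type) (b0 : B) m (P : nat -> B -> Prop) :
  (forall i, (i < m)%N -> exists b, P i b) ->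
  exists f, forall i, (i < m)%N -> P i (f i).
Proof.
move=> h; apply: (fun_choice (P := fun i b => (i < m)%N -> P i b)) => i.
by case: (ltnP i m) => [/h[b Pb]|_]; [exists b | exists b0].
Qed.

Lemma pbP (P : Prop) : reflect P (pb P).
Proof. by rewrite /pb; case: excluded_middle_informative => h; constructor. Qed.

Section Dimension.
Variables (n : nat) (R : fieldType).
Notation S := {mpoly R[n]}.
Implicit Types (I J : S -> Prop) (p q g : S) (s t : seq S).

(** Coefficients are functions on [nat] whose values past the length of [s] are irrelevant;
    concatenating lists then only shifts an index. *)
Definition lincomb (c : nat -> R) s : S := \sum_(i < size s) c i *: s`_i.

Definition indep I s :=
  forall c, I (lincomb c s) -> forall i, (i < size s)%N -> c i = 0.

Definition spans I j s :=
  forall p, p \is j.-homog -> exists c, I (p - lincomb c s).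

Definition forms j s := forall i, (i < size s)%N -> s`_i \is j.-homog.

Definition basis I j s := [/\ forms j s, indep I s & spans I j s].

Lemma lincomb_homog j c s : forms j s -> lincomb c s \is j.-homog.
Proof. by move=> hs; apply: rpred_sum => i _; apply/rpredZ/hs. Qed.

Lemma lincomb_cat c s t :
  lincomb c (s ++ t) = lincomb c s + lincomb (fun i => c (size s + i)%N) t.
Proof.
rewrite /lincomb size_cat big_split_ord /=; congr (_ + _); apply: eq_bigr => i _.
  by rewrite nth_cat ltn_ord.
by rewrite nth_cat ltnNge leq_addr addKn.
Qed.

Lemma lincombM c s g : lincomb c s * g = lincomb c [seq x * g | x <- s].
Proof.
rewrite /lincomb size_map mulr_suml; apply: eq_bigr => i _.
by rewrite (nth_map 0) // scalerAl.
Qed.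

Lemma lincombZ a d s : lincomb (fun i => a * d i) s = a *: lincomb d s.
Proof. by rewrite /lincomb scaler_sumr; apply: eq_bigr => i _; rewrite scalerA. Qed.

Lemma indepP I s : lin_indep_mod I s <-> indep I s.
Proof.
split=> [h c Ic i lti|h c sc Ic i].
  have := h (mkseq c (size s)); rewrite size_mkseq => /(_ erefl).
  have -> : \sum_(i0 < size s) (mkseq c (size s))`_i0 *: s`_i0 = lincomb c s.
    by apply: eq_bigr => k _; rewrite nth_mkseq.
  by move=> /(_ Ic i); rewrite nth_mkseq.
have [lti|lei] := ltnP i (size s); last by rewrite nth_default // sc.
exact: (h (fun i => c`_i)).
Qed.

Lemma matrix_lker m l (C : 'M[R]_(m, l)) : (l < m)%N ->
  exists2 v : 'rV[R]_m, v != 0 & v *m C = 0.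
Proof.
move=> lt; have: kermx C != 0.
  rewrite -mxrank_eq0 mxrank_ker subn_eq0 -ltnNge.
  exact: leq_ltn_trans (rank_leq_col C) lt.
by case/rowV0Pn=> v /sub_kermxP ? ?; exists v.
Qed.

Lemma spans_lincomb I j s t : is_ideal I -> spans I j t -> forms j s ->
  exists C : nat -> nat -> R, forall c,
    I (lincomb c s - lincomb (fun k => \sum_(i < size s) c i * C i k) t).
Proof.
move=> hI st fs.
have [C hC] : exists C : nat -> nat -> R, forall i, (i < size s)%N ->
    I (s`_i - lincomb (C i) t).
  apply: (fun_choice_nat (fun=> 0 : R) (P := fun i c => I (s`_i - lincomb c t))) => i lti.
  by apply: st; apply: fs.
exists C => c.
have -> : lincomb (fun k => \sum_(i < size s) c i * C i k) t
    = \sum_(i < size s) c i *: lincomb (C i) t.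
  rewrite /lincomb; under eq_bigr do rewrite scaler_suml.
  rewrite exchange_big; apply: eq_bigr => i _ /=; rewrite scaler_sumr.
  by apply: eq_bigr => k _; rewrite scalerA.
rewrite /lincomb -sumrB; apply: ideal_sum => // i _; rewrite -scalerBr.
by apply: idealZ => //; apply: hC.
Qed.

Lemma row_fun m (v : 'rV[R]_m) : exists c : nat -> R, forall i : 'I_m, c i = v 0 i.
Proof.
case: m v => [|m] v; first by exists (fun=> 0) => -[].
by exists (fun i => v 0 (inord i)) => i; rewrite inord_val.
Qed.

(** If s were longer than t, the matrix of coordinates of s in t would have a nonzero left kernel
    vector, which is a relation among s modulo I. *)
Lemma indep_size_spans I j s t : is_ideal I -> spans I j t -> forms j s ->
  indep I s -> (size s <= size t)%N.
Proof.
move=> hI st fs inds; rewrite leqNgt; apply/negP => lt.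
have [C hC] := spans_lincomb hI st fs.
have [v nzv vC] := matrix_lker (\matrix_(i < size s, k < size t) C i k) lt.
have [c hc] := row_fun v.
case/negP: nzv; apply/eqP/rowP => i; rewrite mxE -hc; apply: inds => //.
apply: ideal_eq (hC c) _ => //; rewrite /lincomb.
rewrite big1 => [|k _]; first exact: ideal0.
move/rowP/(_ k): vC; rewrite !mxE => vC.
rewrite (eq_bigr (fun i : 'I_(size s) => v 0 i * (\matrix_(i, k) C i k) i k)) ?vC ?scale0r //.
by move=> l _; rewrite mxE hc.
Qed.

Definition monos j : seq S :=
  [seq 'X_[val m] | m <- enum [pred m : 'X_{1..n < j.+1} | mdeg m == j]].

Lemma spans_monos I j : is_ideal I -> spans I j (monos j).
Proof.
move=> hI p hp.
have E : p = \sum_(m : 'X_{1..n < j.+1} | mdeg m == j) p@_m *: 'X_[m].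
  rewrite -[LHS](pihomog_dE hp) (@pihomogwE _ _ _ _ j.+1) //.
  rewrite msizeE; apply/bigmax_leqP_seq => m min _.
  by rewrite (dhomog_mf hp min).
pose ms := enum [pred m : 'X_{1..n < j.+1} | mdeg m == j].
exists (fun i => p@_(nth 0%MM [seq val m | m <- ms] i)).
rewrite (_ : lincomb _ _ = p) ?subrr; first exact: ideal0.
have {2}-> : p = \sum_(m <- ms) p@_(val m) *: 'X_[val m] by rewrite {1}E /ms big_enum.
rewrite /lincomb /monos size_map -/ms.
case: ms => [|m0 ms']; first by rewrite big_nil big_ord0.
rewrite (big_nth m0) big_mkord; apply: eq_bigr => i _.
by rewrite !(nth_map m0).
Qed.

(** Exponents of a monomial of degree j are at most j. With [indep_size_spans] this shows that the
    cutoff in the definition of [HF] loses nothing. *)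
Lemma size_monos j : (size (monos j) <= j.+1 ^ n)%N.
Proof.
rewrite size_map -cardE.
apply: leq_trans (max_card _) _.
rewrite -[X in (_ <= X ^ _)%N]card_ord -[X in (_ <= _ ^ X)%N]card_ord -card_ffun.
pose f (m : 'X_{1..n < j.+1}) : {ffun 'I_n -> 'I_j.+1} :=
  [ffun i => inord ((m : 'X_{1..n}) i)].
apply: (@leq_card _ _ f) => m1 m2 /ffunP E; apply/val_inj/mnmP => i /=.
have lt (m : 'X_{1..n < j.+1}) : ((m : 'X_{1..n}) i < j.+1)%N.
  apply: leq_ltn_trans (bmdeg m); rewrite mdegE (bigD1 i) //=; exact: leq_addr.
by have := congr1 (@nat_of_ord _) (E i); rewrite !ffunE !inordK.
Qed.

Lemma HF_max I j s : is_ideal I -> forms j s -> indep I s -> (size s <= HF I j)%N.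
Proof.
move=> hI fs inds.
have lt : (size s < (j.+1 ^ n).+1)%N.
  rewrite ltnS; apply: leq_trans (size_monos j).
  exact: indep_size_spans hI (spans_monos (j:=j) hI) fs inds.
rewrite /HF; apply: (@leq_bigmax_cond _ _ _ (Ordinal lt)).
apply/pbP; exists s; split=> //; last exact/indepP.
by apply/(all_nthP 0) => i lti; apply: fs.
Qed.

Lemma HF_basis I j : is_ideal I -> exists2 s, basis I j s & size s = HF I j.
Proof.
move=> hI.
have [s [ss fs inds]] : exists s, [/\ size s = HF I j, forms j s & indep I s].
  have : pb (indep_forms I j (@ord0 (j.+1 ^ n)%N)).
    by apply/pbP; exists [::]; split=> // c sc _ i; rewrite nth_default // sc.
  move=> h0; rewrite /HF.
  have [m] := @eq_bigmax_cond _ [pred m : 'I_(j.+1 ^ n).+1 | pb (indep_forms I j m)]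
    (@nat_of_ord _) (ltac:(by apply/card_gt0P; exists ord0)).
  move=> /pbP[s [ss /all_nthP fs /indepP inds]] ->; exists s; split=> //.
  by move=> i lti; apply: fs.
exists s => //; split=> // p hp.
(* By maximality of s, appending p destroys independence. *)
have nind : ~ indep I (rcons s p).
  move=> ind; have := HF_max hI _ ind (j := j).
  rewrite size_rcons ss ltnn => h; case: (notF (h _)) => i.
  rewrite size_rcons ltnS nth_rcons; case: ltngtP => // lt _; exact: fs.
have [c [Ic ex]] : exists c, I (lincomb c s + c (size s) *: p) /\
     exists2 i, (i <= size s)%N & c i <> 0.
  apply: Classical_Prop.NNPP => h; apply: nind => c.
  rewrite -cats1 lincomb_cat {2}/lincomb big_ord1 /= addn0 => Ic i.
  rewrite size_cat addn1 ltnS => lei; apply: Classical_Prop.NNPP => ne.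
  by apply: h; exists c; split=> //; exists i.
(* Without p the relation would live among s alone and be trivial. *)
have nz : c (size s) != 0.
  apply/negP => /eqP E; case: ex => i; rewrite leq_eqVlt => /orP[/eqP->//|lt]; apply.
  by apply: inds lt; move: Ic; rewrite E scale0r addr0.
exists (fun i => - (c (size s))^-1 * c i); rewrite lincombZ scaleNr opprK.
rewrite -[p](scalerK nz) -scalerDr addrC; exact: idealZ.
Qed.

Lemma HF_le_spans I j t : is_ideal I -> spans I j t -> (HF I j <= size t)%N.
Proof.
move=> hI st; have [s [fs inds _] <-] := HF_basis j hI.
exact: indep_size_spans hI st fs inds.
Qed.

Lemma HF_eq I j s : is_ideal I -> basis I j s -> HF I j = size s.
Proof.
move=> hI [fs inds ss]; apply/eqP; rewrite eqn_leq HF_le_spans //=.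
exact: HF_max.
Qed.

Lemma HF_mono I J j : is_ideal I -> is_ideal J ->
  (forall p, p \is j.-homog -> I p -> J p) -> (HF J j <= HF I j)%N.
Proof.
move=> hI hJ IJ; have [s [fs _ ss] <-] := HF_basis j hI.
apply: HF_le_spans => // p hp; have [c Ic] := ss p hp; exists c.
by apply: IJ => //; rewrite rpredB // lincomb_homog.
Qed.

Lemma HF_ext I J j : is_ideal I -> is_ideal J ->
  (forall p, p \is j.-homog -> I p <-> J p) -> HF I j = HF J j.
Proof.
move=> hI hJ E; apply/eqP; rewrite eqn_leq; apply/andP; split;
by apply: HF_mono => // p hp; case: (E p hp).
Qed.

Lemma HF_eq0 I j : is_ideal I -> (HF I j == 0)%N <-> (forall p, p \is j.-homog -> I p).
Proof.
move=> hI; split=> [/eqP E p hp|h].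
  have [s [_ _ ss]] := HF_basis j hI; rewrite E => /size0nil s0.
  by have [c] := ss p hp; rewrite s0 /lincomb big_ord0 subr0.
rewrite -leqn0 (_ : 0%N = size (@nil S)) //; apply: HF_le_spans => // p hp.
by exists (fun=> 0); rewrite /lincomb big_ord0 subr0; apply: h.
Qed.

Definition addI I g : S -> Prop := fun p => exists a, I (p - a * g).

Lemma addI_is_ideal I g : is_ideal I -> is_ideal (addI I g).
Proof.
move=> hI; split.
- by exists 0; rewrite mul0r subr0; exact: ideal0.
- move=> p q [a Ia] [b Ib]; exists (a + b).
  by rewrite mulrDl opprD addrACA; apply: idealD.
- by move=> p q [a Ia]; exists (p * a); rewrite -mulrA -mulrBr; apply: idealM.
Qed.

Lemma addI_homog I g d p e : is_ideal I -> homog_ideal I -> g \is d.-homog ->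
  p \is (e + d)%N.-homog -> addI I g p ->
  exists2 a, a \is e.-homog & I (p - a * g).
Proof.
move=> hI hom hg hp [a Ia]; exists (pihomog mdeg e a); first exact: pihomogP.
by move: (hom _ (e + d)%N Ia); rewrite raddfB /= pihomogMr // (pihomog_dE hp).
Qed.

(** Exactness of 0 -> S/(I : g)(-d) -> S/I -> S/(I + (g)) -> 0: a basis of the right term, followed
    by g times a basis of the left one, is a basis of the middle one. *)
Lemma HF_add I g d j : is_ideal I -> homog_ideal I -> g \is d.-homog ->
  HF I (j + d) = (HF (addI I g) (j + d) + HF (colon I g) j)%N.
Proof.
move=> hI hom hg.
have hA := addI_is_ideal g hI; have hC := colon_is_ideal g hI.
have [s [fs inds ss] <-] := HF_basis (j + d) hA.
have [t [ft indt st] <-] := HF_basis j hC.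
rewrite (@HF_eq _ _ (s ++ [seq x * g | x <- t])) ?size_cat ?size_map //.
split.
- move=> i; rewrite size_cat size_map nth_cat => lti.
  have [/fs//|lei] := ltnP i (size s).
  rewrite (nth_map 0); last by rewrite ltn_subLR.
  by apply: dhomogM => //; apply: ft; rewrite ltn_subLR.
- move=> c; rewrite lincomb_cat -lincombM => Ic.
  have c0 : forall i, (i < size s)%N -> c i = 0.
    apply: inds; exists (- lincomb (fun i => c (size s + i)%N) t).
    by rewrite mulNr opprK.
  move=> i; rewrite size_cat size_map => lti.
  have [/c0//|lei] := ltnP i (size s).
  rewrite -(subnKC lei); apply: (indt (fun i => c (size s + i)%N)).
    rewrite /colon; move: Ic; rewrite [lincomb c s]big1 ?add0r // => k _.
    by rewrite c0 ?scale0r.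
  by rewrite ltn_subLR.
- move=> p hp; have [c Ac] := ss p hp.
  have hpc : p - lincomb c s \is (j + d)%N.-homog by rewrite rpredB // lincomb_homog.
  have [a ha Ia] := addI_homog hI hom hg hpc Ac.
  have [b Ib] := st a ha.
  exists (fun i => if (i < size s)%N then c i else b (i - size s)%N).
  rewrite lincomb_cat -lincombM.
  have -> : lincomb (fun i => if (i < size s)%N then c i else b (i - size s)%N) s = lincomb c s.
    by apply: eq_bigr => i _; rewrite ltn_ord.
  have -> : lincomb (fun i => if (size s + i < size s)%N then c (size s + i)%N else b (size s + i - size s)%N) t = lincomb b t.
    by apply: eq_bigr => i _; rewrite ltnNge leq_addr addKn.
  rewrite (_ : _ - _ = (p - lincomb c s - a * g) + (a - lincomb b t) * g); last by ring.
  exact: idealD.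
Qed.

Lemma HF_add_small I g d j : is_ideal I -> homog_ideal I -> g \is d.-homog ->
  (j < d)%N -> HF (addI I g) j = HF I j.
Proof.
move=> hI hom hg lt; apply: HF_ext => //; first exact: addI_is_ideal.
move=> p hp; split=> [[a /(hom _ j)]|Ip].
  by rewrite raddfB /= (pihomog_dE hp) (pihomogMr_small _ hg lt) subr0.
by exists 0; rewrite mul0r subr0.
Qed.

Lemma HF_gen_rcons gs g j : HF (gen_ideal (rcons gs g)) j = HF (addI (gen_ideal gs) g) j.
Proof.
apply: HF_ext => //; first exact: addI_is_ideal.
by move=> p _; apply: gen_rcons.
Qed.

End Dimension.

(** * Koszul homology of regular sequences *)

Section Koszul.
Variables (n : nat) (R : fieldType).
Notation S := {mpoly R[n]}.
Implicit Types (I J : S -> Prop) (p q g : S) (fs xs : seq S) (ds : seq nat).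
Implicit Types (c b : seq bool -> S) (A B : seq bool).

(** Weakly regular sequence: the ideal generated may be the unit ideal. *)
Definition wreg fs :=
  forall i, (i < size fs)%N -> nzd_mod (gen_ideal (take i fs)) fs`_i.

Lemma wreg_rcons fs g : wreg (rcons fs g) <-> wreg fs /\ nzd_mod (gen_ideal fs) g.
Proof.
split=> [h|[h hg] i].
  split=> [i lti|].
    have := h i; rewrite size_rcons ltnW // nth_rcons lti -cats1 takel_cat; last exact: ltnW.
    exact.
  have := h (size fs); rewrite size_rcons ltnSn nth_rcons ltnn eqxx -cats1.
  by rewrite take_size_cat //; apply.
rewrite size_rcons ltnS leq_eqVlt => /orP[/eqP->|lti].
  by rewrite nth_rcons ltnn eqxx -cats1 take_size_cat.
by rewrite nth_rcons lti -cats1 takel_cat; [apply: h | apply: ltnW].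
Qed.

Definition homs fs ds :=
  size fs = size ds /\ forall i, (i < size fs)%N -> fs`_i \is (nth 0%N ds i).-homog.

Lemma homs_rcons fs g ds d :
  homs (rcons fs g) (rcons ds d) <-> homs fs ds /\ g \is d.-homog.
Proof.
rewrite /homs !size_rcons; split=> [[[sE] h]|[[sE h] hg]].
  split; last by have := h (size fs); rewrite ltnSn !nth_rcons ltnn sE ltnn !eqxx; apply.
  split=> // i lti; have := h i; rewrite !nth_rcons -sE lti; apply; exact: ltnW.
split=> [|i]; first by rewrite sE.
rewrite ltnS leq_eqVlt !nth_rcons -sE => /orP[/eqP->|lti].
  by rewrite ltnn eqxx.
by rewrite lti; apply: h.
Qed.

Lemma homs_homog_ideal fs ds : homs fs ds -> homog_ideal (gen_ideal fs).
Proof. by move=> [_ h]; apply: gen_homog => i /h; exists (nth 0%N ds i). Qed.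

(* Koszul differential on x_1, ..., x_r: a chain is a function of masks, the
   basis vector of a mask being the wedge of the selected e_i.  K_j is not
   carved out: statements about K_j quantify over the masks of size r and
   weight j, and values elsewhere are irrelevant. *)
Fixpoint dK xs c A : S :=
  if xs is x :: xs' then
    if A is a :: A' then
      if a then - dK xs' (fun B => c (true :: B)) A'
      else dK xs' (fun B => c (false :: B)) A' + x * c (true :: A')
    else 0
  else 0.

Lemma dK_lin xs f c b A :
  dK xs (fun B => f * c B + b B) A = f * dK xs c A + dK xs b A.
Proof.
elim: xs c b A => [|x xs IH] c b [|[] A] /=; rewrite ?mulr0 ?addr0 ?IH //; ring.
Qed.

Lemma dK0 xs A : dK xs (fun=> 0) A = 0.
Proof. by elim: xs A => [|x xs IH] [|[] A] //=; rewrite IH ?oppr0 // mulr0 addr0. Qed.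

Lemma dK_ideal xs c A I : is_ideal I ->
  (forall x B, x \in xs -> size B = size A -> count id B = (count id A).+1 -> I (x * c B)) ->
  I (dK xs c A).
Proof.
move=> hI; elim: xs c A => [|x xs IH] c [|[] A] h //=; try exact: ideal0.
  apply: idealN => //; apply: IH => y B yin sB cB; apply: h.
  - by rewrite inE yin orbT.
  - by rewrite /= sB.
  - by rewrite /= cB.
apply: idealD => //; last by apply: h; rewrite ?mem_head.
apply: IH => y B yin sB cB; apply: h => //.
- by rewrite inE yin orbT.
- by rewrite /= sB.
Qed.

(** The differential at A reads only the masks with one more selected entry, which is why no
    subspace of chains has to be carved out. *)
Lemma dK_ext xs c b A :
  (forall B, size B = size A -> count id B = (count id A).+1 -> c B = b B) ->
  dK xs c A = dK xs b A.
Proof.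
elim: xs c b A => [|x xs IH] c b [|[] A] h //=.
  by congr (- _); apply: IH => B sB cB; apply: h => /=; rewrite ?sB ?cB.
rewrite h //; congr (_ + _).
by apply: IH => B sB cB; apply: h => /=; rewrite ?sB ?cB.
Qed.

Lemma dKZ xs f c A : dK xs (fun B => f * c B) A = f * dK xs c A.
Proof.
rewrite -[RHS]addr0 -(dK0 xs A) -dK_lin; apply: dK_ext => B _ _.
by rewrite addr0.
Qed.

Lemma dKN xs c A : dK xs (fun B => - c B) A = - dK xs c A.
Proof. by rewrite -mulN1r -dKZ; apply: dK_ext => B _ _; rewrite mulN1r. Qed.

Lemma dKD xs c b A : dK xs (fun B => c B + b B) A = dK xs c A + dK xs b A.
Proof.
by rewrite -[dK xs c A]mul1r -dK_lin; apply: dK_ext => B _ _; rewrite mul1r.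
Qed.

Lemma dKB xs c b A : dK xs (fun B => c B - b B) A = dK xs c A - dK xs b A.
Proof. by rewrite dKD dKN. Qed.

Lemma dKK xs c A : dK xs (dK xs c) A = 0.
Proof.
elim: xs c A => [|x xs IH] c [|[] A] //=; first by rewrite dKN IH !oppr0.
by rewrite dKD dKZ IH; ring.
Qed.

Lemma dK_top xs c : dK xs c (nseq (size xs) true) = 0.
Proof. by elim: xs c => [|x xs IH] c //=; rewrite IH oppr0. Qed.

Lemma dK_homog xs c A e : (forall x, x \in xs -> x \is 1.-homog) ->
  (forall B, size B = size A -> count id B = (count id A).+1 -> c B \is e.-homog) ->
  dK xs c A \is e.+1.-homog.
Proof.
elim: xs c A => [|x xs IH] c [|[] A] hx h /=; try exact: rpred0.
  rewrite rpredN; apply: IH => [y yin|B sB cB]; first by rewrite hx // inE yin orbT.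
  by apply: h; rewrite /= ?sB ?cB.
apply: rpredD; last by rewrite -add1n dhomogM ?h ?hx ?mem_head.
apply: IH => [y yin|B sB cB]; first by rewrite hx // inE yin orbT.
by apply: h; rewrite /= ?sB ?cB.
Qed.

Lemma dK_pihomog xs c A e : (forall x, x \in xs -> x \is 1.-homog) ->
  pihomog mdeg e.+1 (dK xs c A) = dK xs (fun B => pihomog mdeg e (c B)) A.
Proof.
elim: xs c A => [|x xs IH] c [|[] A] hx /=; rewrite ?raddf0 ?raddfN ?raddfD /= ?IH //.
- by move=> y yin; rewrite hx // inE yin orbT.
- by rewrite -addn1 mulrC pihomogMr ?hx ?mem_head // mulrC.
- by move=> y yin; rewrite hx // inE yin orbT.
Qed.

Lemma dK_pihomog0 xs c A : (forall x, x \in xs -> x \is 1.-homog) ->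
  pihomog mdeg 0 (dK xs c A) = 0.
Proof.
elim: xs c A => [|x xs IH] c [|[] A] hx /=; rewrite ?raddf0 ?raddfN ?raddfD /= ?IH ?oppr0 //.
- by move=> y yin; rewrite hx // inE yin orbT.
- by rewrite mulrC (pihomogMr_small _ (hx x (mem_head _ _))) // addr0.
- by move=> y yin; rewrite hx // inE yin orbT.
Qed.

(** Regularity read from the right: each entry is a nonzerodivisor modulo the entries after it,
    matching the recursion of [dK]. *)
Fixpoint regK xs :=
  if xs is x :: xs' then nzd_mod (gen_ideal xs') x /\ regK xs' else True.

(** The boundaries in homological degree 0 are the elements of the ideal. *)
Lemma gen_dK xs p :
  gen_ideal xs p <-> exists c, p = dK xs c (nseq (size xs) false).
Proof.
elim: xs p => [|x xs IH] p.
  rewrite gen_nil; split=> [->|[c ->]] //; by exists (fun=> 0).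
rewrite gen_cons; split=> [[a /IH[c pE]]|[c ->]].
  exists (fun B => if B is true :: _ then a else c (behead B)) => /=.
  by rewrite -(subrK (a * x) p) pE mulrC.
exists (c (true :: nseq (size xs) false)); apply/IH.
by exists (fun B => c (false :: B)) => /=; rewrite mulrC addrK.
Qed.

Lemma count_id0 A : count id A = 0%N -> A = nseq (size A) false.
Proof. by elim: A => //= -[] //= A IH /IH{1}->. Qed.

(** The Koszul complex of x :: xs is the mapping cone of multiplication by x on that of xs. The part
    of c on masks containing x is a boundary dK b', by induction, or by regularity of x in weight 0.
    Then the part without x, corrected by x b', is a cycle for xs and again a boundary. *)
Lemma koszul_acyclic xs j c : regK xs ->
  (forall A, size A = size xs -> count id A = j -> dK xs c A = 0) ->
  exists b, forall A, size A = size xs -> count id A = j.+1 -> c A = dK xs b A.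
Proof.
elim: xs j c => [|x xs IH] j c; first by exists (fun=> 0) => -[].
move=> [nz reg] h.
have [b' hb'] : exists b', forall A, size A = size xs -> count id A = j ->
    c (true :: A) = dK xs b' A.
  case: j h => [|j] h; last first.
    apply: (IH j) => // A sA cA; have := h (true :: A); rewrite /= sA cA => /(_ erefl erefl).
    by move/eqP; rewrite oppr_eq0 => /eqP.
  have := h (nseq (size xs).+1 false); rewrite /= size_nseq count_nseq => /(_ erefl erefl) E.
  have : gen_ideal xs (c (true :: nseq (size xs) false) * x).
    rewrite mulrC -(addKr (dK xs (fun B => c (false :: B)) (nseq (size xs) false)) (x * _)) E addr0.
    by apply: idealN => //; apply/gen_dK; exists (fun B => c (false :: B)).
  move=> /nz/gen_dK[b' hb']; exists b' => A sA /count_id0->; rewrite sA; exact: hb'.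
have [|a' ha'] := IH j (fun B => c (false :: B) + x * b' B) reg.
  move=> A sA cA; rewrite dKD dKZ -hb' //.
  by have := h (false :: A); rewrite /= sA cA; apply.
exists (fun B => if B is a :: B' then if a then - b' B' else a' B' else 0).
move=> [|[] A] //= [sA].
  by rewrite add1n => -[cA]; rewrite dKN opprK hb'.
rewrite add0n => cA; by rewrite mulrN -ha' // addrK.
Qed.

(* Koszul homology of S/(f_1, ..., f_h) in homological degree j only lives in
   degrees at least the sum of some j of the d_i.  The entries of a chain have
   degree [e] here, so its internal degree is [e + j].  Adding f to the
   sequence: if dc = g f modulo the previous ideal, then g is a cycle because f
   is regular, and c corrected by f times a primitive of g is a cycle for the
   previous ideal. *)
Lemma koszul_vanish xs fs ds j e c : regK xs -> (forall x, x \in xs -> x \is 1.-homog) ->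
  homs fs ds -> wreg fs ->
  (forall t, subseq t ds -> size t = j -> (e + j < sumn t)%N) ->
  (forall A, size A = size xs -> count id A = j -> c A \is e.-homog) ->
  (forall A, size A = size xs -> (count id A).+1 = j -> gen_ideal fs (dK xs c A)) ->
  exists b, forall A, size A = size xs -> count id A = j -> gen_ideal fs (c A - dK xs b A).
Proof.
move=> reg hx; elim/last_ind: fs ds j e c => [|fs f IH] ds j e c hfs wfs ht hc cyc.
  case: j ht hc cyc => [|j] ht hc cyc; first by have := ht [::] (sub0seq _) erefl.
  have [|b hb] := koszul_acyclic (j := j) (c := c) reg.
    by move=> A sA cA; apply/gen_nil/cyc => //; rewrite cA.
  by exists b => A sA cA; rewrite hb // subrr; apply: ideal0.
case/lastP: ds hfs ht => [[]|ds d]; first by rewrite size_rcons.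
move=> /homs_rcons[hfs hf] ht; move/wreg_rcons: wfs => [wfs nzf].
have hom := homs_homog_ideal hfs.
have dhom A : size A = size xs -> (count id A).+1 = j -> dK xs c A \is e.+1.-homog.
  by move=> sA cA; apply: dK_homog => // B sB cB; apply: hc; rewrite ?sB ?cB.
have ht' : forall t, subseq t ds -> size t = j -> (e + j < sumn t)%N.
  move=> t st; apply: ht; apply: subseq_trans st _; exact: subseq_rcons.
(* If dc has degree below d, no multiple of f can occur in it, and c is already a cycle modulo
   fs. *)
have [lt|le] := ltnP e.+1 d.
  have [|b hb] := IH ds j e c hfs wfs ht' hc.
    move=> A sA cA; have /gen_rcons[a /(hom _ e.+1)] := cyc A sA cA.
    by rewrite raddfB /= (pihomogMr_small _ hf lt) subr0 pihomog_dE // dhom.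
  by exists b => A sA cA; apply/gen_rcons_sub/hb.
(* In homological degree 0 the degree hypothesis on the empty subsequence is absurd. *)
case: j ht ht' hc cyc dhom => [|j] ht ht' hc cyc dhom.
  by have := ht [::] (sub0seq _) erefl.
pose e' := (e.+1 - d)%N; have eE : e.+1 = (e' + d)%N by rewrite subnK.
have [G hG] : exists G, forall A, size A = size xs -> count id A = j ->
    G A \is e'.-homog /\ gen_ideal fs (dK xs c A - G A * f).
  apply: (fun_choice (P := fun A g => size A = size xs -> count id A = j ->
    g \is e'.-homog /\ gen_ideal fs (dK xs c A - g * f))) => A.
  case: (classic (size A = size xs /\ count id A = j)) => [[sA cA]|nA]; last first.
    by exists 0 => sA cA; case: nA.
  have cA1 : (count id A).+1 = j.+1 by rewrite cA.
  have /gen_rcons AI := cyc A sA cA1.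
  have := dhom A sA cA1; rewrite eE => hd.
  by have [a ha Ia] := addI_homog (gen_is_ideal fs) hom hf hd AI; exists a.
have [|||b0 hb0] := IH ds j e' G hfs wfs.
- move=> t st sz; have := ht (rcons t d); rewrite size_rcons sz sumn_rcons.
  by rewrite -!cats1 cat_subseq // => /(_ isT erefl); lia.
- by move=> A sA cA; case: (hG A sA cA).
- move=> A sA cA; apply: nzf; rewrite mulrC -dKZ.
  rewrite -[X in gen_ideal _ X]opprK -[X in - X]add0r -(dKK xs c A) -dKB; apply: idealN => //.
  apply: dK_ideal => // x B _ sB cB; apply: idealM => //.
  by rewrite [f * _]mulrC; have [] := hG B (etrans sB sA) (etrans cB cA).
(* The primitive of G is cut down to its component of degree e' - 1, so that f times it has degree e
   like c. For e' = 0 the component of a boundary in degree 0 vanishes, so 0 is a primitive. *)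
pose bh := if e' is e''.+1 then fun A => pihomog mdeg e'' (b0 A) else fun=> 0.
have hbh A : size A = size xs -> count id A = j -> gen_ideal fs (G A - dK xs bh A).
  move=> sA cA; have [hGA _] := hG A sA cA; have := hom _ e' (hb0 A sA cA).
  rewrite raddfB /= (pihomog_dE hGA) /bh; case: (e') => [|e''].
    by rewrite dK_pihomog0 // dK0.
  by rewrite dK_pihomog.
have [||b hb] := IH ds j.+1 e (fun A => c A - f * bh A) hfs wfs ht'.
- move=> A sA cA; apply: rpredB; first exact: hc.
  rewrite /bh; case: (e') eE => [|e''] eE; first by rewrite mulr0 rpred0.
  have -> : e = (d + e'')%N by lia.
  by apply: dhomogM => //; apply: pihomogP.
- move=> A sA [cA]; rewrite dKB dKZ.
  have [_ h1] := hG A sA cA; have h2 := hbh A sA cA.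
  have -> : dK xs c A - f * dK xs bh A = (dK xs c A - G A * f) + f * (G A - dK xs bh A) by ring.
  by apply: idealD => //; apply: idealM.
exists b => A sA cA; apply/gen_rcons; exists (bh A).
by have := hb A sA cA; rewrite addrAC [f * _]mulrC.
Qed.

(** F times the wedge of all e_i is a cycle modulo fs. There are no boundaries in top homological
    degree, so if every sum of [size xs] of the degrees were too large, [koszul_vanish] would put F
    in the ideal. *)
Lemma killed_by_regular xs fs ds e F : regK xs -> (forall x, x \in xs -> x \is 1.-homog) ->
  homs fs ds -> wreg fs -> F \is e.-homog -> ~ gen_ideal fs F ->
  (forall x, x \in xs -> gen_ideal fs (x * F)) ->
  exists t, [/\ subseq t ds, size t = size xs & (sumn t <= e + size xs)%N].
Proof.
move=> reg hx hfs wfs hF nF kill; apply: Classical_Prop.NNPP => nex; case: nF.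
pose c A := if A == nseq (size xs) true then F else 0.
have [|||b hb] := @koszul_vanish xs fs ds (size xs) e c reg hx hfs wfs.
- move=> t st sz; rewrite ltnNge; apply/negP => le; apply: nex; by exists t.
- by move=> A _ _; rewrite /c; case: ifP => _ //; apply: rpred0.
- move=> A _ _; apply: dK_ideal => // x B xin _ _; rewrite /c; case: ifP => _.
    exact: kill.
  by rewrite mulr0; apply: ideal0.
have := hb (nseq (size xs) true); rewrite size_nseq count_nseq mul1n => /(_ erefl erefl).
by rewrite dK_top subr0 /c eqxx.
Qed.

End Koszul.

(** * Linear forms *)

Section LinearForms.
Variables (n : nat) (R : fieldType).
Notation S := {mpoly R[n]}.
Implicit Types (I J : S -> Prop) (p q g : S) (fs xs : seq S) (ds : seq nat).

(** Every monomial of a combination of monomials is divisible by one of them; conversely p is the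
    sum of its terms. *)
Lemma mono_genP (us : seq 'X_{1..n}) p :
  gen_ideal [seq 'X_[u] | u <- us] p <->
  (forall m, m \in msupp p -> exists2 u, u \in us & (u <= m)%MM).
Proof.
split.
  move=> /gen_idealP[c ->] m; rewrite size_map mcoeff_msupp => nz.
  have [i hi] : exists i : 'I_(size us), (c i * [seq 'X_[u] | u <- us]`_i)@_m != 0.
    apply/existsP; move: nz; apply: contraNT; rewrite negb_exists => /forallP h.
    by rewrite raddf_sum /= big1 // => i _; apply/eqP; rewrite -[_ == _]negbK.
  move: hi; rewrite -mcoeff_msupp (nth_map 0%MM) // (perm_mem (msuppMX _ _)).
  case/mapP=> m' _ ->; exists (nth 0%MM us i); first exact: mem_nth.
  exact: lem_addr.
move=> h; rewrite (mpolyE p) big_seq; apply: ideal_sum => // m /h[u uin le].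
apply: idealZ => //; rewrite -(submK le) mpolyXD; apply: idealM => //.
by apply: gen_in; apply: map_f.
Qed.

Lemma var_nzd (s : seq 'I_n) i : i \notin s ->
  nzd_mod (gen_ideal [seq 'X_k | k <- s]) ('X_i : S).
Proof.
move=> nin p; have E : [seq 'X_k | k <- s] = [seq 'X_[u] : S | u <- [seq U_(k)%MM | k <- s]].
  by rewrite -map_comp.
rewrite E !mono_genP => h m min.
have [|u uin] := h (U_(i) + m)%MM.
- by rewrite (perm_mem (msuppMX _ _)) map_f.
case/mapP: uin => k kin -> le; exists U_(k)%MM; first by apply/mapP; exists k.
move: le; rewrite !lep1mP mnmDE mnm1E.
by have /negbTE-> : i != k by apply: contraNneq nin => ->.
Qed.

Lemma var_regK (s : seq 'I_n) : uniq s -> regK [seq 'X_k : S | k <- s].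
Proof. by elim: s => //= i s IH /andP[nin /IH]; split=> //; apply: var_nzd. Qed.

Lemma var_homog i : ('X_i : S) \is 1.-homog.
Proof. by rewrite dhomogX; apply/eqP/mdeg1. Qed.

Definition linform (A : 'M[R]_n) i : S := \sum_j A i j *: 'X_j.

Definition linsub (A : 'M[R]_n) : S -> S := comp_mpoly [tuple linform A i | i < n].

HB.instance Definition _ A := GRing.RMorphism.on (linsub A).

Lemma linsubZ A c p : linsub A (c *: p) = c *: linsub A p.
Proof. exact: comp_mpolyZ. Qed.

Lemma linsubX A i : linsub A 'X_i = linform A i.
Proof. by rewrite /linsub comp_mpolyXU -tnth_nth tnth_mktuple. Qed.

Lemma linform_homog A i : linform A i \is 1.-homog.
Proof. by apply: rpred_sum => j _; apply: rpredZ; apply: var_homog. Qed.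

Lemma linsubK A : A \in unitmx -> cancel (linsub (invmx A)) (linsub A).
Proof.
move=> uA p.
have EX i : linsub A (linsub (invmx A) 'X_i) = 'X_i.
  rewrite linsubX /linform rmorph_sum /=.
  under eq_bigr do rewrite linsubZ linsubX /linform scaler_sumr.
  rewrite exchange_big /= (bigD1 i) //= [X in _ + X]big1 ?addr0.
    under eq_bigr do rewrite scalerA.
    rewrite -scaler_suml; have := mulVmx uA => /matrixP/(_ i i).
    by rewrite !mxE eqxx => ->; rewrite scale1r.
  move=> k ne; under eq_bigr do rewrite scalerA.
  rewrite -scaler_suml; have := mulVmx uA => /matrixP/(_ i k).
  by rewrite !mxE eq_sym (negbTE ne) => ->; rewrite scale0r.
elim/mpolyind: p => [|c m p _ _ IH]; first by rewrite !rmorph0.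
rewrite !rmorphD /= IH !linsubZ; congr (_ *: _ + _).
rewrite mpolyXE_id !rmorph_prod; apply: eq_bigr => i _.
by rewrite !rmorphXn /= EX.
Qed.

Lemma linsub_gen A xs p : gen_ideal xs p -> gen_ideal [seq linsub A x | x <- xs] (linsub A p).
Proof.
move=> /gen_idealP[c ->]; rewrite rmorph_sum; apply: ideal_sum => // i _.
rewrite rmorphM; apply: idealM => //; apply: gen_in; apply: map_f; exact: mem_nth.
Qed.

(** An invertible linear substitution is an automorphism carrying the variables to these forms, so
    regularity is transported from [var_nzd]. *)
Lemma linform_regK A (s : seq 'I_n) : A \in unitmx -> uniq s ->
  regK [seq linform A k | k <- s].
Proof.
move=> uA; have uA' : invmx A \in unitmx by rewrite unitmx_inv.
elim: s => //= i s IH /andP[nin us]; split; last exact: IH.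
have E : [seq linform A k | k <- s] = [seq linsub A x | x <- [seq 'X_k | k <- s]].
  by rewrite -map_comp; apply: eq_map => k /=; rewrite linsubX.
move=> p; rewrite E => /(linsub_gen (invmx A)).
have K := linsubK uA'; rewrite invmxK in K.
rewrite -map_comp (eq_map (g := id)) ?map_id; last exact: K.
rewrite rmorphM /= -linsubX K => /(var_nzd nin) /(linsub_gen A).
by rewrite linsubK.
Qed.

(** The linear forms killing F modulo fs have dimension at least n - HF(S/(f : F); 1), and
    [killed_by_regular] applies to a basis of a space of that size. *)
Lemma linear_annihilators fs ds e F : homs fs ds -> wreg fs ->
  F \is e.-homog -> ~ gen_ideal fs F ->
  exists t, [/\ subseq t ds, (n <= size t + HF (colon (gen_ideal fs) F) 1)%N
                & (sumn t <= e + size t)%N].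
Proof.
move=> hfs wfs hF nF; have hJ := colon_is_ideal F (gen_is_ideal fs).
have [s [_ _ ss] sE] := HF_basis 1 hJ.
have [C hC] : exists C : 'I_n -> nat -> R, forall i, colon (gen_ideal fs) F ('X_i - lincomb (C i) s).
  by apply: (fun_choice (P := fun i c => colon (gen_ideal fs) F ('X_i - lincomb c s)))
    => i; apply: ss; apply: var_homog.
pose M := \matrix_(i < n, k < size s) C i k.
(* Row i of M holds coordinates of the i-th variable modulo (f : F), so left kernel vectors are
   linear forms killing F. [row_ebase] completes a basis of the kernel to an invertible matrix, as
   [linform_regK] requires. *)
pose K := kermx M; pose E := row_ebase K.
have uE : E \in unitmx := row_ebase_unit K.
have kill (i : 'I_n) : (i < \rank K)%N -> gen_ideal fs (linform E i * F).
  move=> lti; pose v := row i E.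
  have /sub_kermxP vM : (v <= K)%MS.
    apply: submx_trans (_ : row_base K <= K)%MS; last by rewrite eq_row_base.
    apply/submxP; exists (\row_(j < \rank K) (j == i :> nat)%:R).
    apply/rowP => k; rewrite [RHS]mxE (bigD1 (Ordinal lti)) //= big1 => [|j ne]; last first.
      have /negbTE ne' : j != i :> nat by [].
      by rewrite mxE ne' mul0r.
    rewrite [X in X * _]mxE eqxx mul1r addr0 /row_base [RHS]mxE.
    rewrite (bigD1 i) //= big1 => [|j ne]; last first.
      rewrite [X in X * _]mxE /= (_ : (i == j :> nat) = false) ?mul0r //.
      by apply/negbTE; rewrite eq_sym.
    by rewrite [X in X * _]mxE eqxx lti mul1r addr0 /v mxE.
  have -> : linform E i = \sum_j E i j *: ('X_j - lincomb (C j) s).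
    under [RHS]eq_bigr do rewrite scalerBr.
    rewrite sumrB [X in _ - X](_ : _ = 0) ?subr0 //.
    rewrite /lincomb; under eq_bigr do rewrite scaler_sumr.
    rewrite exchange_big big1 // => k _ /=; under eq_bigr do rewrite scalerA.
    rewrite -scaler_suml; move/rowP/(_ k): vM; rewrite !mxE => vM.
    rewrite (eq_bigr (fun j => v 0 j * M j k)) ?vM ?scale0r // => j _.
    by rewrite !mxE.
  rewrite -/(colon (gen_ideal fs) F _).
  by apply: ideal_sum => // j _; apply: idealZ => //; apply: hC.
pose xs := [seq linform E i | i : 'I_n <- enum [pred i : 'I_n | (i < \rank K)%N]].
have sxs : size xs = \rank K.
  rewrite size_map -cardE (eq_card (B := [set widen_ord (rank_leq_row K) i | i in 'I_(\rank K)])).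
    by rewrite card_imset ?card_ord // => a b /(congr1 val) /= /val_inj.
  move=> i; rewrite !inE; apply/idP/imsetP => [lti|[k _ ->]].
    by exists (Ordinal lti) => //; apply: val_inj.
  exact: (ltn_ord k).
have [|||t [st tE le]] := @killed_by_regular _ _ xs fs ds e F _ _ hfs wfs hF nF.
- exact/linform_regK/enum_uniq.
- by move=> x /mapP[i _ ->]; apply: linform_homog.
- by move=> x /mapP[i]; rewrite mem_enum => /kill + ->.
exists t; split=> //; last by rewrite tE.
rewrite tE sxs mxrank_ker -sE.
have := rank_leq_col M; have := rank_leq_row M; lia.
Qed.

Lemma socle_degree fs ds e F : homs fs ds -> wreg fs -> F \is e.-homog ->
  ~ gen_ideal fs F -> (forall i, gen_ideal fs ('X_i * F)) ->
  exists t, [/\ subseq t ds, size t = n & (sumn t <= e + n)%N].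
Proof.
move=> hfs wfs hF nF kill; pose xs := [seq 'X_i : S | i <- enum 'I_n].
have sxs : size xs = n by rewrite size_map size_enum_ord.
have [|||t [st tE le]] := @killed_by_regular _ _ xs fs ds e F _ _ hfs wfs hF nF.
- exact/var_regK/enum_uniq.
- by move=> x /mapP[i _ ->]; apply: var_homog.
- by move=> x /mapP[i _ ->].
by exists t; rewrite -sxs.
Qed.

End LinearForms.

(** * Hilbert series of regular sequences *)

Lemma hockey_stick r j : (\sum_(k < j.+1) 'C(k + r, r) = 'C(j + r.+1, r.+1))%N.
Proof.
elim: j => [|j IH]; first by rewrite big_ord1 !add0n !binn.
by rewrite big_ord_recr IH /= [in RHS]addSn binS addSnnS.
Qed.

(** * Power series modulo a power of X *)

Section TruncatedSeries.
Implicit Types (p q r : {poly int}) (N : nat).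

(** Congruence modulo X^N lets polynomials stand for Hilbert series. *)
Definition eqN N p q := forall i, (i < N)%N -> p`_i = q`_i.

Lemma eqN_sym N p q : eqN N p q -> eqN N q p.
Proof. by move=> h i lt; rewrite h. Qed.
Lemma eqN_trans N p q r : eqN N p q -> eqN N q r -> eqN N p r.
Proof. by move=> h1 h2 i lt; rewrite h1 // h2. Qed.
Lemma eqN_mul N p q r : eqN N p q -> eqN N (r * p) (r * q).
Proof.
move=> h i lt; rewrite !coefM; apply: eq_bigr => k _; rewrite h //.
exact: leq_ltn_trans (leq_subr _ _) lt.
Qed.

Lemma coef_1BX p i : ((1 - 'X) * p)`_i = p`_i - (if i is i'.+1 then p`_i' else 0).
Proof. by rewrite mulrBl mul1r coefB coefXM; case: i. Qed.

(** 1 - X is a unit among power series: coefficients are recovered from below. *)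
Lemma eqN_cancel N (k : nat) p q : eqN N ((1 - 'X) ^+ k * p) ((1 - 'X) ^+ k * q) -> eqN N p q.
Proof.
elim: k p q => [|k IH] p q; first by rewrite !mul1r.
rewrite !exprSr -!mulrA => /IH h; elim=> [|i IHi] lt; have := h _ lt; rewrite !coef_1BX.
  by rewrite !subr0.
by rewrite IHi => [/addIr//|]; apply: ltnW.
Qed.

Lemma coef_sum_1BX p i : \sum_(k < i.+1) ((1 - 'X) * p)`_k = p`_i.
Proof.
elim: i => [|i IH]; first by rewrite big_ord1 coef_1BX subr0.
by rewrite big_ord_recr IH /= coef_1BX addrC subrK.
Qed.

Lemma partial_sum_le_at1 q j : (forall i, 0 <= q`_i) -> \sum_(i < j.+1) q`_i <= q.[1].
Proof.
move=> q0; rewrite horner_coef; under [leRHS]eq_bigr do rewrite expr1n mulr1.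
have [le|lt] := leqP (size q) j.+1.
  rewrite (big_ord_widen _ (fun i => q`_i) le) [leRHS]big_mkcond /=.
  by apply: ler_sum => i _; case: ltnP => // /(nth_default 0)->.
rewrite (big_ord_widen _ (fun i => q`_i) (ltnW lt)) big_mkcond /=.
by apply: ler_sum => i _; case: ifP.
Qed.

(** Dividing by 1 - X takes partial sums. A partial sum of q is at most q(1), and each further
    summation raises the binomial coefficient by [hockey_stick]. *)
Lemma cumulative_bound N (r : nat) p q : eqN N ((1 - 'X) ^+ r * p) q -> (forall i, 0 <= q`_i) ->
  forall j, (j < N)%N -> \sum_(i < j.+1) p`_i <= q.[1] *+ 'C(j + r, r).
Proof.
move=> + q0; elim: r p => [|r IH] p h j lt.
  rewrite bin0 mulr1n; apply: le_trans (partial_sum_le_at1 j q0).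
  apply: ler_sum => i _; rewrite -h ?mul1r //; exact: leq_ltn_trans (leq_ord i) lt.
rewrite exprSr -mulrA in h.
rewrite -hockey_stick -sumrMnr; apply: ler_sum => i _.
rewrite -coef_sum_1BX; apply: IH h _ _; exact: leq_ltn_trans (leq_ord i) lt.
Qed.

(** The product of the (1 - X^d) / (1 - X): the Hilbert series of an artinian complete intersection
    of degrees ds. *)
Definition qpoly (ds : seq nat) : {poly int} := \prod_(d <- ds) \poly_(i < d) 1.

Lemma poly1_1BX d : (1 - 'X) * \poly_(i < d) 1 = 1 - 'X^d :> {poly int}.
Proof.
apply/polyP => i; rewrite coef_1BX coefB coef1 coefXn !coef_poly.
case: i => [|i]; first by case: d => [|d] /=; rewrite ?subr0 ?subrr.
by rewrite coef_poly /=; case: (ltngtP i.+1 d) => cmp; rewrite ?subrr ?subr0 ?sub0r.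
Qed.

Lemma qpoly_1BX ds : (1 - 'X) ^+ size ds * qpoly ds = \prod_(d <- ds) (1 - 'X^d).
Proof.
rewrite /qpoly; elim: ds => [|d ds IH]; first by rewrite !big_nil mulr1.
by rewrite !big_cons /= exprS mulrACA poly1_1BX IH.
Qed.

Lemma qpoly_ge0 ds i : 0 <= (qpoly ds)`_i.
Proof.
rewrite /qpoly; elim: ds i => [|d ds IH] i; first by rewrite big_nil coef1; case: (i == 0)%N.
rewrite big_cons coefM; apply: sumr_ge0 => k _; apply: mulr_ge0 => //.
by rewrite coef_poly; case: ifP.
Qed.

Lemma qpoly_at1 ds : (qpoly ds).[1] = (\prod_(d <- ds) d)%N%:R.
Proof.
rewrite /qpoly horner_prod natr_prod; apply: eq_bigr => d _.
rewrite horner_poly; under eq_bigr do rewrite expr1n mul1r.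
by rewrite sumr_const card_ord.
Qed.

Lemma qpoly_monic ds : (forall d, d \in ds -> (0 < d)%N) ->
  qpoly ds \is monic /\ size (qpoly ds) = (sigma ds).+1.
Proof.
rewrite /qpoly /sigma; elim: ds => [|d ds IH] h; first by rewrite !big_nil monic1 size_poly1.
rewrite !big_cons; have [|mq sq] := IH; first by move=> x xin; rewrite h // inE xin orbT.
have d0 : (0 < d)%N by rewrite h ?mem_head.
have sd : size (\poly_(i < d) 1 : {poly int}) = d.
  by case: d d0 {h} => // d _; rewrite size_poly_eq ?oner_neq0.
have md : (\poly_(i < d) 1 : {poly int}) \is monic.
  by apply/monicP; rewrite lead_coefE sd coef_poly prednK // leqnn.
split; first by rewrite monicMl.
by rewrite size_Mmonic ?monic_neq0 // sd sq; lia.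
Qed.

End TruncatedSeries.

(** * Hilbert functions modulo regular sequences of forms *)

Section HilbertRegular.
Variables (n : nat) (R : fieldType).
Notation S := {mpoly R[n]}.
Implicit Types (I J : S -> Prop) (p q g : S) (fs xs : seq S) (ds : seq nat).

Definition Hser N fs : {poly int} := \poly_(i < N) (HF (gen_ideal fs) i)%:Z.

Lemma Hser_rcons N fs g d : homog_ideal (gen_ideal fs) -> g \is d.-homog ->
  nzd_mod (gen_ideal fs) g -> eqN N (Hser N (rcons fs g)) ((1 - 'X^d) * Hser N fs).
Proof.
move=> hom hg nz i lt; rewrite mulrBl mul1r coefB coefXnM !coef_poly lt.
rewrite HF_gen_rcons; case: ltnP => le.
  by rewrite (HF_add_small _ hom hg) // subr0.
rewrite (leq_ltn_trans (leq_subr _ _) lt) -[in LHS](subnK le) -[in X in _ = X - _](subnK le).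
rewrite [in RHS](HF_add _ _ hom hg) //.
rewrite (_ : HF (colon _ _) _ = HF (gen_ideal fs) (i - d)) ?PoszD ?addrK //.
apply: HF_ext => // [|p _]; first exact: colon_is_ideal.
by split=> [/nz//|h]; apply: ideal_mulr.
Qed.

Lemma Hser_reg N fs ds : homs fs ds -> wreg fs ->
  eqN N (Hser N fs) (\prod_(d <- ds) (1 - 'X^d) * Hser N [::]).
Proof.
elim/last_ind: fs ds => [|fs g IH] ds.
  by case: ds => [|d ds] [] //= _ _ _; rewrite big_nil mul1r.
case/lastP: ds => [[]|ds d]; first by rewrite size_rcons.
move=> /homs_rcons[hfs hg] /wreg_rcons[wfs nz].
apply: eqN_trans (Hser_rcons (homs_homog_ideal hfs) hg nz) _.
rewrite -cats1 big_cat big_seq1 /= [_ * (1 - _)]mulrC -mulrA.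
by apply: eqN_mul; apply: IH.
Qed.

Lemma Hser_vars N : eqN N (Hser N [seq 'X_i | i <- enum 'I_n]) 1.
Proof.
move=> i lt; rewrite coef_poly lt coef1.
set xs := [seq _ | i <- _]; have hI := gen_is_ideal xs.
have big (m : 'X_{1..n}) : mdeg m != 0%N -> gen_ideal xs ('X_[m] : S).
  move=> nz; have [k hk] : exists k, m k != 0%N.
    apply/existsP; apply: contraNT nz; rewrite negb_exists => /forallP h.
    by rewrite mdegE big1 // => k _; apply/eqP; rewrite -[_ == _]negbK.
  rewrite -(submK (m := U_(k)) (m' := m)) ?lep1mP // mpolyXD; apply: idealM => //.
  by apply: gen_in; apply: map_f; rewrite mem_enum.
case: i lt => [|i] lt /=.
  rewrite (@HF_eq _ _ _ _ [:: 1]) //; split.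
  - by case=> // _; apply: dhomog1.
  - move=> c; rewrite /lincomb big_ord1 /= => h [] // _.
    have E : xs = [seq 'X_[u] : S | u <- [seq U_(k)%MM | k <- enum 'I_n]].
      by rewrite /xs -map_comp.
    move: h; rewrite E mono_genP => h; apply: contraTeq isT => nz.
    have [|u /mapP[k _ ->]] := h 0%MM.
      by rewrite mcoeff_msupp mcoeffZ mcoeff1 eqxx mulr1.
    by rewrite lep1mP mnm0E.
  - move=> p hp; exists (fun=> p@_0%MM); rewrite /lincomb big_ord1 /=.
    rewrite (_ : _ - _ = 0) ?(ideal0 hI) //; last first.
    apply/eqP; rewrite subr_eq0; apply/eqP/mpolyP => m.
    rewrite mcoeffZ mcoeff1; case: eqP => [->|/eqP ne]; first by rewrite mulr1.
    by rewrite mulr0 (dhomog_nemf_coeff hp) // mdeg_eq0.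
  exact: ideal0.
apply/eqP; rewrite eqz_nat; apply/(HF_eq0 _ hI) => p hp.
rewrite (mpolyE p) big_seq; apply: ideal_sum => // m /(dhomog_mf hp) E.
by apply: idealZ => //; apply: big; rewrite E.
Qed.

Lemma vars_homs : homs [seq 'X_i : S | i <- enum 'I_n] (nseq n 1%N).
Proof.
split=> [|i]; first by rewrite size_map size_enum_ord size_nseq.
rewrite size_map size_enum_ord => lti; rewrite nth_nseq lti.
by rewrite (nth_map (Ordinal lti)) ?size_enum_ord //; apply: var_homog.
Qed.

Lemma vars_wreg : wreg [seq 'X_i : S | i <- enum 'I_n].
Proof.
move=> i; rewrite size_map size_enum_ord => lti.
rewrite -map_take (nth_map (Ordinal lti)) ?size_enum_ord //; apply: var_nzd.
rewrite (nth_ord_enum (Ordinal lti) (Ordinal lti)).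
apply/negP => /(nthP (Ordinal lti))[k]; rewrite size_take size_enum_ord lti => ltk.
rewrite nth_take // => /(congr1 val); rewrite /= nth_enum_ord ?(ltn_trans ltk) // => E.
by rewrite E ltnn in ltk.
Qed.

(** The variables form a regular sequence with quotient the base field, so the formula for regular
    sequences yields the series of S without counting monomials. *)
Lemma Hser_nil N : eqN N ((1 - 'X) ^+ n * Hser N [::]) 1.
Proof.
apply: eqN_trans (@Hser_vars N); apply: eqN_sym.
have := Hser_reg (N := N) vars_homs vars_wreg.
by rewrite big_nseq -Monoid.iteropE -/(GRing.exp _ _).
Qed.

Lemma Hser_qpoly N fs ds : homs fs ds -> wreg fs -> (size fs <= n)%N ->
  eqN N ((1 - 'X) ^+ (n - size fs) * Hser N fs) (qpoly ds).
Proof.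
move=> hfs wfs le; apply: (@eqN_cancel _ (size fs)).
rewrite mulrA -exprD subnKC // (hfs.1) qpoly_1BX.
apply: eqN_trans (eqN_mul _ (Hser_reg hfs wfs)) _.
rewrite mulrCA -[X in eqN _ _ X]mulr1; apply: eqN_mul; exact: Hser_nil.
Qed.

Lemma HF_artinian fs ds j : homs fs ds -> wreg fs -> size fs = n ->
  (HF (gen_ideal fs) j)%:Z = (qpoly ds)`_j.
Proof.
move=> hfs wfs sE; have := Hser_qpoly (N := j.+1) hfs wfs.
rewrite sE subnn mul1r leqnn => /(_ isT j (ltnSn j)).
by rewrite coef_poly ltnSn.
Qed.

Lemma HF_artinian_top fs ds : homs fs ds -> wreg fs -> size fs = n ->
  (forall d, d \in ds -> (0 < d)%N) -> HF (gen_ideal fs) (sigma ds) = 1%N.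
Proof.
move=> hfs wfs sE dpos; apply/eqP; rewrite -eqz_nat (HF_artinian _ hfs) //.
have [/monicP mq sq] := qpoly_monic dpos.
by move: mq; rewrite lead_coefE sq => ->.
Qed.

Lemma HF_artinian_above fs ds j : homs fs ds -> wreg fs -> size fs = n ->
  (forall d, d \in ds -> (0 < d)%N) -> (sigma ds < j)%N -> HF (gen_ideal fs) j = 0%N.
Proof.
move=> hfs wfs sE dpos lt; apply/eqP; rewrite -eqz_nat (HF_artinian _ hfs) //.
by have [_ sq] := qpoly_monic dpos; rewrite nth_default // sq.
Qed.

(** A member of degree 0 is a constant: if nonzero it generates the unit ideal, and if zero its
    regularity puts 1 in the ideal before it. *)
Lemma reg_degree_pos fs ds : homs fs ds -> wreg fs -> ~ gen_ideal fs 1 ->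
  forall d, d \in ds -> (0 < d)%N.
Proof.
move=> [sE hfs] wfs n1 d /(nthP 0%N)[i]; rewrite -sE => lti <-.
rewrite lt0n; apply/negP => /eqP E; apply: n1.
have := hfs i lti; rewrite E => h0.
have fE : fs`_i = (fs`_i)@_0 *: 1.
  apply/mpolyP => m; rewrite mcoeffZ mcoeff1; case: eqP => [->|/eqP ne]; first by rewrite mulr1.
  by rewrite mulr0 (dhomog_nemf_coeff h0) // mdeg_eq0.
have [z|nz] := eqVneq (fs`_i)@_0 0.
  have : gen_ideal (take i fs) 1.
    by apply: (wfs i lti); rewrite fE z scale0r mulr0; apply: ideal0.
  by apply: gen_incl => x; apply: mem_take.
rewrite -(scalerK nz 1) -fE; apply: idealZ => //; exact: gen_mem.
Qed.

(** After n members the quotient is artinian with a nonzero part in top degree sigma; a further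
    member has positive degree and kills that part, so it is a zero divisor. *)
Lemma reg_size fs ds : homs fs ds -> wreg fs -> ~ gen_ideal fs 1 -> (size fs <= n)%N.
Proof.
elim/last_ind: fs ds => [|fs g IH] ds; first by [].
case/lastP: ds => [[]|ds d]; first by rewrite size_rcons.
move=> hfg wfg n1; have dpos := reg_degree_pos hfg wfg n1.
move: hfg wfg => /homs_rcons[hfs hg] /wreg_rcons[wfs nz].
have n1' : ~ gen_ideal fs 1 by move=> /(gen_rcons_sub g).
have := IH ds hfs wfs n1'; rewrite size_rcons leq_eqVlt => /orP[/eqP sE|//].
have dpos' x : x \in ds -> (0 < x)%N.
  by move=> xin; apply: dpos; rewrite mem_rcons inE xin orbT.
have d0 : (0 < d)%N by apply: dpos; rewrite mem_rcons inE eqxx.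
have := HF_artinian_top hfs wfs sE dpos' => h1.
have /eqP/(HF_eq0 _ (gen_is_ideal fs)) h0 : HF (gen_ideal fs) (sigma ds + d) = 0%N.
  by apply: HF_artinian_above wfs sE dpos' _ => //; rewrite -addn1 leq_add2l.
have /(HF_eq0 _ (gen_is_ideal fs)) E : forall w, w \is (sigma ds).-homog -> gen_ideal fs w.
  by move=> w hw; apply: nz; apply: h0; apply: dhomogM.
by rewrite h1 in E.
Qed.

Lemma cum_HF_upper fs ds j : homs fs ds -> wreg fs -> ~ gen_ideal fs 1 ->
  (\sum_(i < j.+1) HF (gen_ideal fs) i <=
     (\prod_(d <- ds) d) * 'C(j + (n - size fs), n - size fs))%N.
Proof.
move=> hfs wfs n1; have le := reg_size hfs wfs n1.
have := cumulative_bound (@Hser_qpoly j.+1 _ _ hfs wfs le) (qpoly_ge0 ds) (ltnSn j).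
rewrite qpoly_at1 -mulrnA -lez_nat -!natz natr_sum; apply: le_trans.
by apply: ler_sum => i _; rewrite coef_poly ltn_ord natz.
Qed.

End HilbertRegular.

(** * The artinian case *)

Section Combinatorics.
Local Open Scope nat_scope.
Implicit Types (ds t : seq nat).

(* For sorted [ds], [psi ds e] is the number of variables that are not
   saturated in the monomial U_e, hence equal to phi_(e+1) for e < sigma. *)
Definition psi ds e := \sum_(k < size ds) (e < sigma (take k.+1 ds)).

(** The number to be subtracted from the product of the degrees, with [psi] in place of phi. The
    value 1 for D >= sigma is the contribution of degree 0; it keeps [bound] positive for forms of
    every degree. *)
Definition bound ds D :=
  if D < sigma ds then
    2 + \sum_(D.+1 <= m < ((sigma ds + D - 1) %/ 2).+1) psi ds m.-1
      + \sum_(D.+1 <= m < ((sigma ds + D) %/ 2).+1) psi ds m.-1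
  else 1.

Lemma sigma_cat s t : sigma (s ++ t) = sigma s + sigma t.
Proof. by rewrite /sigma big_cat. Qed.

Lemma sigma_ones r : sigma (nseq r 1) = 0.
Proof. by rewrite /sigma big_nseq; elim: r. Qed.

Lemma sigma_sumn t : (forall d, d \in t -> 0 < d) -> sumn t = sigma t + size t.
Proof.
rewrite /sigma; elim: t => [|d t IH] h; first by rewrite big_nil.
rewrite big_cons /= IH => [|x xin]; last by rewrite h // inE xin orbT.
by have := h d (mem_head _ _); lia.
Qed.

Lemma sigma_take_mono ds i j : i <= j -> sigma (take i ds) <= sigma (take j ds).
Proof.
by move=> /subnKC<-; rewrite takeD sigma_cat leq_addr.
Qed.

Lemma sigma_take_cons d ds m : sorted leq (d :: ds) -> m <= size ds ->
  sigma (take m (d :: ds)) <= sigma (take m ds).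
Proof.
elim: m d ds => [|m IH] d [|d' ds] // /andP[le srt] lt.
rewrite [take _ (d :: _)]/= [X in _ <= sigma X]/= /sigma !big_cons.
by rewrite leq_add ?leq_sub2r //; apply: IH.
Qed.

(** In a sorted list the initial segment has the least sum among subsequences of its length. *)
Lemma sigma_take_subseq ds t : sorted leq ds -> subseq t ds ->
  sigma (take (size t) ds) <= sigma t.
Proof.
rewrite /sigma; elim: ds t => [|d ds IH] t srt; first by rewrite subseq0 => /eqP->.
have srt' := subseq_sorted leq_trans (subseq_cons ds d) srt.
case: t => [|x t] /=; first by rewrite big_nil.
case: eqP => [->|_] sub; first by rewrite !big_cons leq_add2l IH.
apply: leq_trans (IH _ srt' sub); exact: (sigma_take_cons srt (size_subseq sub)).
Qed.

(** The ones are the degrees of linear sections and add nothing to sigma. If t1 is the part of t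
    inside ds, the first [size t1] degrees already have sigma at most e, so these indices do not
    count in [psi]. *)
Lemma psi_subseq ds r t e : sorted leq ds -> subseq t (ds ++ nseq r 1) -> sigma t <= e ->
  size t + psi ds e <= size ds + r.
Proof.
move=> srt /subseqP[m sm ->]; rewrite -(cat_take_drop (size ds) m).
have sm1 : size (take (size ds) m) = size ds.
  by rewrite size_takel // sm size_cat leq_addr.
rewrite mask_cat // size_cat sigma_cat.
set t1 := mask _ ds; set t2 := mask _ _ => le.
have s1 : subseq t1 ds := mask_subseq _ _.
have l2 : size t2 <= r.
  by rewrite -(size_nseq r 1); apply: size_subseq; apply: mask_subseq.
have le1 : sigma (take (size t1) ds) <= e.
  apply: leq_trans (sigma_take_subseq srt s1) _; exact: leq_trans (leq_addr _ _) le.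
have lt1 := size_subseq s1.
suff le2 : psi ds e <= size ds - size t1.
  by rewrite -(subnKC lt1) -!addnA leq_add2l addnC leq_add.
rewrite /psi -(subnKC lt1) big_split_ord /= big1 ?add0n => [|i _]; last first.
  apply/eqP; rewrite eqb0 -leqNgt; apply: leq_trans le1; exact: sigma_take_mono.
rewrite addKn; apply: (@leq_trans (\sum_(i < size ds - size t1) 1)).
  by apply: leq_sum => i _; case: (_ < _).
by rewrite sum1_card card_ord.
Qed.

(** The two end values of H give the 2. The interior splits into 1, ..., A and a block of length B,
    which symmetry reflects to 1, ..., B. *)
Lemma sum_symmetric_bound (H f : nat -> nat) s D : D < s ->
  (forall i, i <= s - D -> H i = H (s - D - i)) -> 0 < H 0 ->
  (forall m, D < m <= s -> f m <= H (m - D)) ->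
  2 + \sum_(D.+1 <= m < ((s + D - 1) %/ 2).+1) f m
    + \sum_(D.+1 <= m < ((s + D) %/ 2).+1) f m <= \sum_(i < (s - D).+1) H i.
Proof.
move=> lt sym h0 hf; set L := s - D.
(* A and B are the floor and the ceiling of (L - 1) / 2, the numbers of interior degrees in the two
   halves. *)
pose A := (s + D - 1) %/ 2 - D; pose B := (s + D) %/ 2 - D.
have AB : A + B = L - 1 by rewrite /A /B /L; lia.
have EA : ((s + D - 1) %/ 2).+1 = A.+1 + D by rewrite /A; lia.
have EB : ((s + D) %/ 2).+1 = B.+1 + D by rewrite /B; lia.
rewrite EA EB -[D.+1]add1n !big_addn !addnK.
have L0 : 0 < L by rewrite /L subn_gt0.
have hs C : C < L -> \sum_(1 <= i < C.+1) f (i + D) <= \sum_(1 <= i < C.+1) H i.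
  move=> ltC; rewrite !big_nat; apply: leq_sum => i /andP[i1 i2].
  by rewrite -[X in H X](addnK D) hf //; rewrite /L in ltC; lia.
have split_sum : \sum_(i < L.+1) H i
    = H 0 + \sum_(1 <= i < A.+1) H i + \sum_(1 <= i < B.+1) H i + H L.
  rewrite -(big_mkord predT) big_nat_recr //= big_ltn //; congr (_ + _).
  rewrite -addnA; congr (_ + _); rewrite (@big_cat_nat _ _ _ A.+1) /=; [|lia|lia].
  congr (_ + _); rewrite big_nat_rev /=.
  rewrite (_ : \sum_(A.+1 <= i < L) _ = \sum_(1 + A <= i < L) H (i - A)).
    rewrite big_addn (_ : L - A = B.+1); last by lia.
    by apply: eq_bigr => i _; rewrite addnK.
  rewrite add1n !big_nat; apply: eq_bigr => i /andP[i1 i2].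
  by rewrite sym; [congr H|]; rewrite -/L; lia.
rewrite split_sum.
have hL : H L = H 0 by rewrite sym // -/L subnn.
have := hs A; have := hs B; lia.
Qed.

End Combinatorics.

(** * Duality and growth in an artinian complete intersection *)

Section Artinian.
Variables (n : nat) (R : fieldType).
Notation S := {mpoly R[n]}.
Variables (fs : seq S) (ds : seq nat).
Hypotheses (hfs : homs fs ds) (wfs : wreg fs) (nI1 : ~ gen_ideal fs 1) (sz : size fs = n).
Local Notation I := (gen_ideal fs).
Local Notation s := (sigma ds).

Let dpos := reg_degree_pos hfs wfs nI1.
Let hI := gen_is_ideal fs.

Lemma artinian_top p e : p \is e.-homog -> ~ I p -> (e <= s)%N.
Proof.
move=> hp nIp; rewrite leqNgt; apply/negP => lt; apply: nIp.
have /eqP/(HF_eq0 _ hI) := HF_artinian_above hfs wfs sz dpos lt; exact.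
Qed.

(** If all variables killed p, [socle_degree] would give a subsequence of length n, hence all of ds,
    and force e >= sigma. *)
Lemma artinian_step p e : p \is e.-homog -> ~ I p -> (e < s)%N -> exists i, ~ I ('X_i * p).
Proof.
move=> hp nIp lt; apply: Classical_Prop.NNPP => nex.
have [|t [st tn le]] := socle_degree hfs wfs hp nIp.
  by move=> i; apply: Classical_Prop.NNPP => h; apply: nex; exists i.
have E : t = ds.
  have [_ /esym] := size_subseq_leqif st.
  by rewrite tn -hfs.1 sz eqxx => /eqP.
move: le; rewrite E sigma_sumn // -hfs.1 sz leq_add2r leqNgt lt //.
Qed.

Lemma artinian_climb p e k : p \is e.-homog -> ~ I p -> (e + k <= s)%N ->
  exists2 v, v \is k.-homog & ~ I (v * p).
Proof.
move=> hp nIp; elim: k => [|k IH] le; first by exists 1; rewrite ?mul1r // dhomog1.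
have [|v hv nIv] := IH; first by lia.
have [||i nIi] := @artinian_step (v * p) (k + e) _ nIv; first exact: dhomogM.
  by lia.
exists ('X_i * v); last by rewrite -mulrA.
by rewrite -add1n; apply: dhomogM => //; apply: var_homog.
Qed.

Variables (G : S) (D : nat).
Hypotheses (hG : G \is D.-homog) (nIG : ~ I G).
Local Notation J := (colon I G).

Let hJ := colon_is_ideal G hI.

(** Gorenstein duality: (a, b) |-> a b G pairs degrees i and i' of S/J into the one-dimensional top
    degree of S/I, and by [artinian_climb] no nonzero a is orthogonal to everything. *)
Lemma colon_dual_le i i' : (i + i' + D = s)%N -> (HF J i <= HF J i')%N.
Proof.
move=> E.
have [u [fu indu _] <-] := HF_basis i hJ.
have [v [fv _ sv] <-] := HF_basis i' hJ.
have [w [fw _ sw]] := HF_basis s hI; rewrite HF_artinian_top // => w1.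
(* [lam] is the matrix of the pairing in the bases u, v and the generator of the top degree. *)
have [lam hlam] : exists lam : nat * nat -> R, forall ab, (ab.1 < size u)%N -> (ab.2 < size v)%N ->
    I (u`_ab.1 * v`_ab.2 * G - lam ab *: w`_0).
  apply: (fun_choice (P := fun ab l => (ab.1 < size u)%N -> (ab.2 < size v)%N ->
    I (u`_ab.1 * v`_ab.2 * G - l *: w`_0))) => -[a b] /=.
  case: (ltnP a (size u)) => [lta|_]; last by exists 0.
  case: (ltnP b (size v)) => [ltb|_]; last by exists 0.
  have [|c] := sw (u`_a * v`_b * G).
    by rewrite -E; apply: dhomogM => //; apply: dhomogM; [apply: fu | apply: fv].
  by rewrite /lincomb w1 big_ord1 /=; exists (c 0%N).
rewrite leqNgt; apply/negP => lt.
have [x nzx xC] := matrix_lker (\matrix_(a < size u, b < size v) lam (val a, val b)) lt.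
have [c hc] := row_fun x.
have nJp : ~ J (lincomb c u).
  move=> /indu h; case/negP: nzx; apply/eqP/rowP => a; rewrite mxE -hc; exact: h.
have hp : lincomb c u * G \is (i + D)%N.-homog by apply: dhomogM => //; apply: lincomb_homog.
(* A kernel vector gives a form orthogonal to v; climbing to the top yields q of degree i' pairing
   nontrivially with it, although q is a combination of v. *)
have [|q hq nIq] := @artinian_climb _ _ i' hp nJp; first by lia.
have [d hd] := sv q hq; apply: nIq.
have -> : q * (lincomb c u * G) = lincomb c u * ((q - lincomb d v) * G) + lincomb c u * lincomb d v * G.
  by ring.
apply: idealD => //; first exact: idealM.
have -> : lincomb c u * lincomb d v * G =
    \sum_(a < size u) \sum_(b < size v) (c a * d b) *: (u`_a * v`_b * G - lam (val a, val b) *: w`_0).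
  transitivity (\sum_(a < size u) \sum_(b < size v) ((c a * d b) *: (u`_a * v`_b * G))
      - \sum_(a < size u) \sum_(b < size v) ((c a * d b * lam (val a, val b)) *: w`_0)).
    rewrite [X in _ - X](_ : _ = 0) ?subr0.
      rewrite /lincomb !mulr_suml; apply: eq_bigr => a _.
      rewrite mulr_sumr mulr_suml; apply: eq_bigr => b _.
      by rewrite -!scalerAl -scalerAr -scalerAl scalerA.
    rewrite exchange_big big1 // => b _ /=.
    rewrite -scaler_suml; move/rowP/(_ b): xC; rewrite !mxE => xC.
    rewrite (_ : \sum_(a < size u) _ = d b * \sum_a x 0 a * (\matrix_(a, b) lam (val a, val b)) a b).
      by rewrite xC mulr0 scale0r.
    rewrite mulr_sumr; apply: eq_bigr => a _; rewrite mxE hc; ring.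
  rewrite -sumrB; apply: eq_bigr => a _; rewrite -sumrB; apply: eq_bigr => b _.
  by rewrite scalerBr scalerA.
by apply: ideal_sum => // a _; apply: ideal_sum => // b _; apply: idealZ => //; exact: (hlam (val a, val b) (ltn_ord a) (ltn_ord b)).
Qed.

Lemma colon_dual i : (i <= s - D)%N -> HF J i = HF J (s - D - i).
Proof.
have le := artinian_top hG nIG.
by move=> lei; apply/eqP; rewrite eqn_leq !colon_dual_le //; lia.
Qed.

Lemma colon_HF0 : (0 < HF J 0)%N.
Proof.
rewrite lt0n; apply/negP => /(HF_eq0 _ hJ) /(_ 1 (dhomog1 _ _)).
by rewrite /colon mul1r.
Qed.

(** Choose v with v G of degree m - 1 outside I. Multiplication by v embeds the degree 1 part of
    S/(I : v G) into degree m - D of S/J, and [linear_annihilators] bounds the former from below. *)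
Lemma colon_growth m : (D < m <= s)%N ->
  exists t, [/\ subseq t ds, (n <= size t + HF J (m - D))%N & (sigma t <= m.-1)%N].
Proof.
move=> /andP[ltm lem].
have [|v hv nIv] := artinian_climb (k := (m.-1 - D)%N) hG nIG; first by lia.
have hF : v * G \is m.-1.-homog.
  by rewrite (_ : m.-1 = m.-1 - D + D)%N; [apply: dhomogM | lia].
have [t [st le1 le2]] := linear_annihilators hfs wfs hF nIv.
exists t; split=> //.
  apply: leq_trans le1 _; rewrite leq_add2l.
  have -> : (m - D = 1 + (m.-1 - D))%N by lia.
  rewrite (HF_add 1 hJ _ hv); last by apply: colon_homog hG; apply: homs_homog_ideal hfs.
  apply: leq_trans (leq_addl _ _); rewrite (@HF_ext _ _ _ (colon J v)) //.
  - exact: colon_is_ideal.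
  - exact: colon_is_ideal.
  - by move=> p _; rewrite /colon mulrA.
by move: le2; rewrite sigma_sumn ?leq_add2r // => d /(mem_subseq st)/dpos.
Qed.

End Artinian.

Section ArtinianBound.
Variables (n : nat) (R : fieldType).
Notation S := {mpoly R[n]}.

Lemma artinian_bound (fs : seq S) ds r G D' D j : sorted leq ds ->
  homs fs (ds ++ nseq r 1%N) -> wreg fs -> ~ gen_ideal fs 1 -> size fs = n ->
  G \is D'.-homog -> ~ gen_ideal fs G -> (D' <= D)%N -> (sigma ds <= j)%N ->
  (bound ds D <= \sum_(i < j.+1) HF (colon (gen_ideal fs) G) i)%N.
Proof.
move=> srt hfs wfs n1 sz hG nG leD lej.
have hI := gen_is_ideal fs; have sE : sigma (ds ++ nseq r 1%N) = sigma ds.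
  by rewrite sigma_cat sigma_ones addn0.
rewrite /bound; case: ltnP => [lt|_]; last first.
  by rewrite big_ord_recl; apply: leq_trans (leq_addr _ _); apply: (colon_HF0 nG).
(* G is raised to degree exactly D; this enlarges the colon ideal and so only lowers the Hilbert
   function. *)
have [|v hv nv] := artinian_climb hfs wfs n1 sz (k := (D - D')%N) hG nG.
  by rewrite sE; lia.
have hG' : v * G \is D.-homog by rewrite -(subnK leD); apply: dhomogM.
apply: (@leq_trans (\sum_(i < (sigma ds - D).+1) HF (colon (gen_ideal fs) (v * G)) i)).
  apply: sum_symmetric_bound => //.
  - by rewrite -sE; apply: colon_dual.
  - exact: colon_HF0.
  - move=> m hm; have [|t [st le1 le2]] := colon_growth hfs wfs n1 sz hG' nv (m := m).
      by rewrite sE.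
    have := psi_subseq srt st le2.
    have := hfs.1; rewrite size_cat size_nseq sz => <- le3.
    by rewrite -(leq_add2l (size t)); apply: leq_trans le3 _.
apply: (@leq_trans (\sum_(i < (sigma ds - D).+1) HF (colon (gen_ideal fs) G) i)).
  apply: leq_sum => i _; apply: HF_mono; try exact: colon_is_ideal.
  by move=> p _; rewrite /colon mulrCA => h; apply: idealM.
have le : ((sigma ds - D).+1 <= j.+1)%N by lia.
rewrite (big_ord_widen _ (fun i => HF (colon (gen_ideal fs) G) i) le) big_mkcond /=.
by apply: leq_sum => i _; case: ifP.
Qed.

End ArtinianBound.

(** * Adjoining a transcendental *)

Lemma frac_numden (A : idomainType) (x : {fraction A}) :
  exists a b : A, b != 0 /\ tofrac b * x = tofrac a.
Proof.
elim/quotW: x => r; exists (frac r).1, (frac r).2; split; first exact: denom_ratioP.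
unlock tofrac; rewrite -[LHS]FracField.pi_mul /FracField.mulf.
apply/eqmodP; rewrite /= FracField.equivfE.
rewrite !numden_Ratio ?oner_neq0 ?mulf_neq0 ?denom_ratioP //. by rewrite mulr1 mul1r.
all: exact: oner_neq0.
Qed.

Section TranscendentalExtension.
Variables (n : nat) (R : fieldType).
Let K := {fraction {poly R}}.
Notation S := {mpoly R[n]}.
Notation SK := {mpoly K[n]}.
Implicit Types (gs : seq S) (p : S) (q : {poly S}).

Definition ext_const (c : R) : K := tofrac c%:P.
HB.instance Definition _ := GRing.RMorphism.copy ext_const (@tofrac _ \o @polyC R).

Definition ext (p : S) : SK := map_mpoly ext_const p.
HB.instance Definition _ := GRing.RMorphism.copy ext (map_mpoly ext_const).

Lemma extZ c p : ext (c *: p) = ext_const c *: ext p.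
Proof. exact: map_mpolyZ. Qed.

Definition tvar : K := tofrac 'X.

(** The embedding of S[t] into K[x], K = R(t). Up to denominators in R[t] it reaches everything, so
    questions over K become questions about coefficients in t. *)
Definition teval (q : {poly S}) : SK := (map_poly ext q).[tvar%:MP].

HB.instance Definition _ := GRing.RMorphism.copy teval
  (horner_eval (tvar%:MP : SK) \o map_poly ext).

Lemma tevalE q : teval q = \sum_(i < size q) ext q`_i * tvar%:MP ^+ i.
Proof.
rewrite {1}/teval (@horner_coef_wide _ (size q)) ?size_poly //.
by apply: eq_bigr => i _; rewrite coef_map.
Qed.

Lemma teval_ideal (I : SK -> Prop) q : is_ideal I -> (forall a, I (ext q`_a)) -> I (teval q).
Proof.
move=> hI h; rewrite tevalE; apply: ideal_sum => // i _.
by rewrite mulrC; apply: idealM.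
Qed.

Lemma tevalC p : teval p%:P = ext p.
Proof. by rewrite /teval map_polyC hornerC. Qed.

Lemma tevalX : teval 'X = tvar%:MP.
Proof. by rewrite /teval map_polyX hornerX. Qed.

Definition lift_poly (d : {poly R}) : {poly S} := map_poly (@mpolyC n R) d.

Lemma teval_lift d : teval (lift_poly d) = (tofrac d)%:MP.
Proof.
rewrite /teval /lift_poly -map_poly_comp.
elim/poly_ind: d => [|d c IH]; first by rewrite !rmorph0 horner0.
rewrite !rmorphD !rmorphM /= map_polyX map_polyC hornerMXaddC /= IH.
by rewrite /ext /= map_mpolyC.
Qed.

Lemma teval_inj q : teval q = 0 -> q = 0.
Proof.
move=> q0; apply/polyP => a; apply/mpolyP => m; rewrite coef0 mcoeff0.
have : tofrac (\poly_(i < size q) (q`_i)@_m) = 0 :> K.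
  rewrite -[RHS](mcoeff0 K m) -q0 tevalE raddf_sum poly_def rmorph_sum /=.
  apply: eq_bigr => i _.
  rewrite -rmorphXn /= mulrC mcoeffCM mulrC /ext mcoeff_map_mpoly.
  by rewrite -mul_polyC rmorphM rmorphXn.
move/eqP; rewrite tofrac_eq0 => /eqP/polyP/(_ a); rewrite coef0 coef_poly.
by case: ltnP => // le _; rewrite nth_default ?mcoeff0.
Qed.

Lemma clear_denominators (p : SK) :
  exists (d : {poly R}) (q : {poly S}), d != 0 /\ (tofrac d)%:MP * p = teval q.
Proof.
elim/mpolyind: p => [|c m p _ _ [d [q [d0 E]]]].
  by exists 1, 0; rewrite oner_neq0 mulr0 rmorph0.
have [a [b [b0 cE]]] := frac_numden c.
exists (b * d), (lift_poly (d * a) * ('X_[m])%:P + lift_poly b * q).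
split; first by rewrite mulf_neq0.
rewrite rmorphD !rmorphM /= !teval_lift -E tevalC /ext map_mpolyX -mul_mpolyC.
rewrite !tofracM -cE !mpolyCM; ring.
Qed.

Lemma clear_denominators_family (c : nat -> SK) k :
  exists (d : {poly R}) (q : nat -> {poly S}), d != 0 /\
    forall i, (i < k)%N -> (tofrac d)%:MP * c i = teval (q i).
Proof.
elim: k => [|k [d [q [d0 E]]]]; first by exists 1, (fun=> 0); rewrite oner_neq0.
have [d' [q' [d0' E']]] := clear_denominators (c k).
exists (d * d'), (fun i => if i == k then lift_poly d * q' else lift_poly d' * q i).
split=> [|i]; first by rewrite mulf_neq0.
rewrite ltnS leq_eqVlt; case: eqP => [-> _|_ lt] /=.
  by rewrite [RHS]rmorphM /= teval_lift -E' tofracM mpolyCM mulrA.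
by rewrite [RHS]rmorphM /= teval_lift -E // tofracM mpolyCM mulrA [_%:MP * _%:MP]mulrC.
Qed.

(** Coefficients of q are treated from the top down: in degree deg d + a the product has the unit
    [lead_coef d] times q_a, plus multiples of higher coefficients of q. *)
Lemma lift_cancel (I : S -> Prop) (d : {poly R}) (q : {poly S}) : is_ideal I -> d != 0 ->
  (forall a, I (lift_poly d * q)`_a) -> forall a, I q`_a.
Proof.
move=> hI d0 h a; have [k] := ubnP (size q - a); elim: k a => // k IH a lek.
have [le|lt] := leqP (size q) a; first by rewrite nth_default //; exact: ideal0.
have {IH} IH b : (a < b)%N -> I q`_b by move=> ab; apply: IH; lia.
pose e := (size d).-1; have se : size d = e.+1 by rewrite prednK // lt0n size_poly_eq0.
have := h (e + a)%N; rewrite coefM.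
rewrite (bigD1 (@Ordinal (e + a).+1 e (ltac:(by rewrite ltnS leq_addr)))) //= addKn => hsum.
rewrite -[q`_a](scalerK (a := lead_coef d)) ?lead_coef_eq0 //; apply: idealZ => //.
rewrite -mul_mpolyC lead_coefE -/e -[_%:MP]/(mpolyC n _) -coef_map /=.
apply: ideal_eq (_ : I (_ - - _)) _ => //; first by rewrite opprK; exact: hsum.
apply: idealN => //; apply: ideal_sum => // i ne.
have [lt'|le'] := ltnP i e.
  by apply: idealM => //; apply: IH; lia.
rewrite coef_map nth_default ?mpolyC0 ?mul0r; first exact: ideal0.
rewrite se; move: ne le'; rewrite -val_eqE /=; lia.
Qed.

(** Clearing denominators turns the relation into an identity in S[t] by [teval_inj]; the common
    denominator is then cancelled by [lift_cancel]. *)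
Lemma ext_gen gs (q : {poly S}) :
  gen_ideal [seq ext g | g <- gs] (teval q) -> forall a, gen_ideal gs q`_a.
Proof.
move=> /gen_idealP[c E]; rewrite size_map in E.
have [d [r [d0 hr]]] := clear_denominators_family c (size gs).
apply: (lift_cancel (d := d)) => // a.
have -> : lift_poly d * q = \sum_(i < size gs) r i * (gs`_i)%:P.
  apply/eqP; rewrite -subr_eq0; apply/eqP/teval_inj.
  rewrite rmorphB rmorphM rmorph_sum /= teval_lift E mulr_sumr -sumrB big1 // => i _.
  by rewrite rmorphM /= tevalC -hr // (nth_map 0) // mulrA subrr.
rewrite coef_sum; apply: ideal_sum => // i _; rewrite coefMC.
by apply: idealM => //; apply: gen_mem.
Qed.

Lemma ext_gen_mono gs p : gen_ideal gs p -> gen_ideal [seq ext g | g <- gs] (ext p).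
Proof.
move=> /gen_idealP[c ->]; rewrite rmorph_sum; apply: ideal_sum => // i _.
rewrite rmorphM; apply: idealM => //; apply: gen_in; apply: map_f; exact: mem_nth.
Qed.

Lemma ext_genE gs p : gen_ideal [seq ext g | g <- gs] (ext p) <-> gen_ideal gs p.
Proof.
split; last exact: ext_gen_mono.
by rewrite -tevalC => /ext_gen/(_ 0%N); rewrite coefC.
Qed.

Lemma ext_nzd gs (L : {poly S}) :
  (forall q, (forall a, gen_ideal gs (q * L)`_a) -> forall a, gen_ideal gs q`_a) ->
  nzd_mod (gen_ideal [seq ext g | g <- gs]) (teval L).
Proof.
move=> h p hp; have [d [q [d0 E]]] := clear_denominators p.
have u : tofrac d != 0 :> K by rewrite tofrac_eq0.
rewrite -[p](scalerK u); apply: idealZ => //; rewrite -mul_mpolyC E.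
apply: teval_ideal => // a; apply: ext_gen_mono; apply: h; apply: ext_gen.
by rewrite rmorphM /= -E -mulrA; apply: idealM.
Qed.

Lemma ext_wreg gs : wreg gs -> wreg [seq ext g | g <- gs].
Proof.
move=> h i; rewrite size_map => lti; rewrite -map_take (nth_map 0) // -tevalC.
apply: ext_nzd => q hq a; apply: (h i lti); have := hq a; by rewrite coefMC.
Qed.

Lemma ext_homog p d : p \is d.-homog -> ext p \is d.-homog.
Proof.
move=> /dhomogP h; apply/dhomogP => m; rewrite mcoeff_msupp /ext mcoeff_map_mpoly fmorph_eq0 => nz.
by apply: h; rewrite mcoeff_msupp.
Qed.

Lemma ext_homs gs ds : homs gs ds -> homs [seq ext g | g <- gs] ds.
Proof.
move=> [sE h]; split=> [|i]; rewrite size_map // => lti.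
by rewrite (nth_map 0) //; apply/ext_homog/h.
Qed.

(** A basis over R expresses all monomials of degree j, so it still spans over K. This direction
    carries lower bounds from K back to R. *)
Lemma ext_HF_colon gs G j :
  (HF (colon (gen_ideal [seq ext g | g <- gs]) (ext G)) j <= HF (colon (gen_ideal gs) G) j)%N.
Proof.
have hJ := colon_is_ideal G (gen_is_ideal gs).
have hJK := colon_is_ideal (ext G) (gen_is_ideal [seq ext g | g <- gs]).
have [t [_ _ st] <-] := HF_basis j hJ.
rewrite -(size_map ext t); apply: HF_le_spans => // p hp.
have [C hC] : exists C : 'X_{1..n} -> nat -> R, forall m, mdeg m = j ->
    colon (gen_ideal gs) G ('X_[m] - lincomb (C m) t).
  apply: (fun_choice (P := fun m c => mdeg m = j -> colon (gen_ideal gs) G ('X_[m] - lincomb c t))) => m.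
  case: (eqVneq (mdeg m) j) => [E|ne]; last by exists (fun=> 0) => E; rewrite E eqxx in ne.
  by have [|c hc] := st 'X_[m]; [rewrite dhomogX; apply/eqP | exists c].
exists (fun i => \sum_(m <- msupp p) p@_m * ext_const (C m i)).
have -> : p - lincomb (fun i => \sum_(m <- msupp p) p@_m * ext_const (C m i)) [seq ext g | g <- t]
   = \sum_(m <- msupp p) p@_m *: ext ('X_[m] - lincomb (C m) t).
  under [RHS]eq_bigr do rewrite rmorphB scalerBr /=.
  rewrite sumrB /= {1}(mpolyE p); congr (_ - _).
    by apply: eq_bigr => m _; rewrite /ext map_mpolyX.
  rewrite /lincomb size_map; under [LHS]eq_bigr do rewrite /= scaler_suml.
  rewrite exchange_big /=; apply: eq_bigr => m _.
  rewrite rmorph_sum scaler_sumr; apply: eq_bigr => i _ /=.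
  by rewrite extZ scalerA (nth_map 0).
rewrite big_seq; apply: ideal_sum => // m min; apply: idealZ => //.
rewrite /colon -rmorphM; apply: ext_gen_mono; apply: hC.
exact: dhomog_mf min.
Qed.

(* McCoy's argument: a zero divisor of least degree in [t] is annihilated by every variable. *)
Lemma generic_linear_nzd gs : (forall p, (forall i, gen_ideal gs ('X_i * p)) -> gen_ideal gs p) ->
  exists2 l : SK, l \is 1.-homog & nzd_mod (gen_ideal [seq ext g | g <- gs]) l.
Proof.
move=> soc; pose L : {poly S} := \sum_(i < n) ('X_i)%:P * 'X^i.
exists (teval L).
  rewrite rmorph_sum; apply: rpred_sum => i _; rewrite rmorphM rmorphXn /= tevalC tevalX.
  rewrite mulrC -rmorphXn /= mul_mpolyC; apply: rpredZ.
  by apply: ext_homog; apply: var_homog.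
apply: ext_nzd => q; have [m] := ubnP (size q); elim: m q => // m IH q.
rewrite ltnS => sq hq.
have qL_coef k : (q * L)`_k = \sum_(j < n) (if (k < j)%N then 0 else q`_(k - j) * 'X_j).
  rewrite mulr_sumr coef_sum; apply: eq_bigr => j _.
  by rewrite mulrA coefMXn; case: ifP => // _; rewrite coefMC.
(* Variables are treated from the last to the first; k is the induction counter. *)
have kill : forall k (i : 'I_n), (n - i <= k)%N -> forall a, gen_ideal gs ('X_i * q`_a).
  elim=> [|k IHk] i; first by move: (ltn_ord i); lia.
  move=> lek; have hgt (j : 'I_n) : (i < j)%N -> forall a, gen_ideal gs ('X_j * q`_a).
    by move=> ij; apply: IHk; lia.
  case: m sq IH => [|m] sq IH.
    by move=> a; rewrite nth_default ?mulr0; [apply: ideal0 | apply: leq_trans sq _].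
  (* In the coefficient of t^(m + i) of q L, terms with j < i involve coefficients of q beyond m,
     and terms with j > i are already in the ideal. *)
  have top : gen_ideal gs ('X_i * q`_m).
    have := hq (m + i)%N; rewrite qL_coef (bigD1 i) //= ltnNge leq_addl /= addnK mulrC => h.
    apply: ideal_eq (_ : gen_ideal gs (_ - - _)) _ => //; first by rewrite opprK; exact: h.
    apply: idealN => //; apply: ideal_sum => // j ne.
    case: ltnP => [_|le]; first exact: ideal0.
    case: (ltngtP j i) => [lt|gt|E].
    - rewrite nth_default ?mul0r; first exact: ideal0.
      by apply: leq_trans sq _; lia.
    - by rewrite mulrC; apply: hgt.
    - by case/eqP: ne; apply: val_inj.
  (* Dropping the top term of x_i q leaves a polynomial of smaller degree that L still kills, so the
     outer induction applies to it. *)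
  pose q' := 'X_i *: q - ('X_i * q`_m) *: 'X^m.
  have q'E a : q'`_a = 'X_i * q`_a - (if a == m then 'X_i * q`_m else 0).
    rewrite coefB !coefZ coefXn; case: eqP => _; by rewrite ?mulr1 ?mulr0.
  have h' : forall a, gen_ideal gs q'`_a.
    apply: IH.
      rewrite ltnS; apply/leq_sizeP => a lea; rewrite q'E.
      case: eqP => [->|/eqP ne]; first by rewrite subrr.
      by rewrite nth_default ?mulr0 ?subr0 //; apply: leq_trans sq _; lia.
    move=> a; rewrite mulrBl -!scalerAl coefB !coefZ; apply: idealB => //.
      exact: idealM.
    by rewrite mulrC; apply: idealM.
  move=> a; have := h' a; rewrite q'E; case: eqP => [-> _|_] //; by rewrite subr0.
by move=> a; apply: soc => i; apply: (kill n); rewrite leq_subr.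
Qed.

End TranscendentalExtension.

(** * Reduction by hyperplane sections *)

Section HyperplaneSection.
Variables (n : nat) (R : fieldType).
Notation S := {mpoly R[n]}.
Implicit Types (fs : seq S) (l G p : S).

Lemma socle_zero fs ds : homs fs ds -> wreg fs -> (size fs < n)%N ->
  forall p, (forall i, gen_ideal fs ('X_i * p)) -> gen_ideal fs p.
Proof.
move=> hfs wfs lt p kill; apply: homog_ideal_comp => // d.
apply: Classical_Prop.NNPP => nI.
have [|t [st tn _]] := socle_degree hfs wfs (pihomogP _ d p) nI.
  move=> i; rewrite mulrC -(pihomogMr p d (var_homog R i)).
  by apply: (homs_homog_ideal hfs); rewrite mulrC.
by have := size_subseq st; rewrite tn -hfs.1 leqNgt lt.
Qed.

(** As long as G lies in (f, l), replace it by its quotient by l modulo f. The degree drops each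
    time, and the colon ideal stays since l is a nonzerodivisor. *)
Lemma divide_out fs ds l G D : homs fs ds -> l \is 1.-homog -> nzd_mod (gen_ideal fs) l ->
  G \is D.-homog -> ~ gen_ideal fs G ->
  exists G' D', [/\ (D' <= D)%N, G' \is D'.-homog, ~ gen_ideal (rcons fs l) G' &
    forall p, colon (gen_ideal fs) G p <-> colon (gen_ideal fs) G' p].
Proof.
move=> hfs hl nz; have hom := homs_homog_ideal hfs.
elim: D G => [|D IH] G hG nG.
  exists G, 0%N; split=> // /gen_rcons[a /(hom _ 0%N)].
  by rewrite raddfB /= (pihomogMr_small _ hl) // subr0 pihomog_dE.
case: (classic (gen_ideal (rcons fs l) G)) => [/gen_rcons gG|ng]; last first.
  by exists G, D.+1.
rewrite -addn1 in hG.
have [a ha Ia] := addI_homog (gen_is_ideal fs) hom hl hG gG.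
have [|G' [D' [leD hG' nG' E]]] := IH a ha.
  by move=> aI; apply: nG; apply: ideal_eq Ia _ => //; apply: ideal_mulr.
exists G', D'; split=> //; first exact: leqW.
move=> p; rewrite -E /colon; split=> h.
  apply: nz; rewrite -mulrA; apply: (ideal_eq (q := p * G)) => //.
  by rewrite -mulrBr; apply: idealM => //; rewrite -opprB; apply: idealN.
apply: (ideal_eq (q := p * (a * l))) => //; first by rewrite -mulrBr; apply: idealM.
by rewrite mulrA; apply: ideal_mulr.
Qed.

(** l is a nonzerodivisor modulo (f : G), and (f : G) + (l) lies in ((f, l) : G). So the first
    difference of the Hilbert function of S/(f : G) dominates the Hilbert function of S/((f, l) :
    G). *)
Lemma hyperplane_HF fs ds l G D j : homs fs ds -> l \is 1.-homog ->
  nzd_mod (gen_ideal fs) l -> G \is D.-homog ->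
  (\sum_(i < j.+1) HF (colon (gen_ideal (rcons fs l)) G) i
     <= HF (colon (gen_ideal fs) G) j)%N.
Proof.
move=> hfs hl nz hG; have hom := homs_homog_ideal hfs.
set J := colon _ G; set J' := colon _ G.
have hJ : is_ideal J by apply: colon_is_ideal.
have hJ' : is_ideal J' by apply: colon_is_ideal.
elim: j => [|j IH].
  by rewrite big_ord1; apply: HF_mono => // p _; apply: gen_rcons_sub.
rewrite big_ord_recr /= -[in X in (_ <= X)%N]addn1 (HF_add j hJ' _ hl); last exact: colon_homog hG.
rewrite addnC leq_add //.
  rewrite addn1; apply: HF_mono => //; first exact: addI_is_ideal.
  move=> p _ [a]; rewrite /J' /J /colon mulrBl => h.
  by apply/gen_rcons; exists (a * G); rewrite mulrAC.
apply: leq_trans IH _; apply: HF_mono => //; first exact: colon_is_ideal.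
by move=> p _; rewrite /J' /colon mulrAC => /nz.
Qed.

End HyperplaneSection.

(** The form serves the induction on r: the field changes, k counts the linear forms adjoined so
    far, and the degree D' of G may drop while the bound stays at ds and D. The shift c absorbs the
    initial degrees. *)
Theorem colon_lower_bound r (R : fieldType) n (fs : seq {mpoly R[n]}) ds k G D' D :
  sorted leq ds -> homs fs (ds ++ nseq k 1%N) -> wreg fs -> n = (size fs + r)%N ->
  G \is D'.-homog -> ~ gen_ideal fs G -> (D' <= D)%N ->
  exists c, forall j, (c <= j)%N ->
    (bound ds D * 'C(j - c + r, r) <= \sum_(i < j.+1) HF (colon (gen_ideal fs) G) i)%N.
Proof.
move=> srt; elim: r R fs k G D' => [|r IH] R fs k G D' hfs wfs nE hG nG leD.
  exists (sigma ds) => j lej; rewrite addn0 bin0 muln1.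
  have I1 : ~ gen_ideal fs 1 by move=> I1; apply: nG; rewrite -[G]mulr1; apply: idealM.
  have sz : size fs = n by move: nE; rewrite addn0 => /esym.
  exact: (artinian_bound srt hfs wfs I1 sz hG nG leD lej).
have lt : (size fs < n)%N by lia.
have [l hl nzl] := generic_linear_nzd (socle_zero hfs wfs lt).
have hfsK := ext_homs hfs; have wfsK := ext_wreg wfs.
have nGK : ~ gen_ideal [seq ext g | g <- fs] (ext G) by rewrite ext_genE.
have [G' [D'' [leD' hG' nG' E]]] := divide_out hfsK hl nzl (ext_homog hG) nGK.
have [|||c hc] := IH _ (rcons [seq ext g | g <- fs] l) k.+1 G' D'' _ _ _ hG' nG' (leq_trans leD' leD).
- have -> : ds ++ nseq k.+1 1%N = rcons (ds ++ nseq k 1%N) 1%N.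
    by rewrite rcons_cat; congr (_ ++ _); elim: (k) => //= m <-.
  exact/homs_rcons.
- exact/wreg_rcons.
- by rewrite size_rcons size_map addSnnS.
exists c => j lej.
apply: (@leq_trans (\sum_(i < j.+1) HF (colon (gen_ideal [seq ext g | g <- fs]) G') i)); last first.
  apply: leq_sum => i _; apply: leq_trans (ext_HF_colon fs G i).
  by apply: HF_mono; try exact: colon_is_ideal; move=> p _ /E.
(* By [hockey_stick] this sum is the binomial bound for r + 1. *)
apply: (@leq_trans (\sum_(c <= i < j.+1) bound ds D * 'C(i - c + r, r))).
  rewrite -{2}[c]add0n big_addn big_mkord -big_distrr /=.
  under eq_bigr do rewrite addnK.
  by rewrite subSn // hockey_stick.
rewrite -(big_mkord predT) [leqRHS](big_cat_nat (n := c)) //=; last exact: leqW.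
apply: leq_trans (leq_addl _ _); rewrite !big_nat; apply: leq_sum => i /andP[lei _].
apply: leq_trans (hc i lei) _; exact: hyperplane_HF hfsK hl nzl hG'.
Qed.

(** * Height *)

Section Height.
Variables (n : nat) (R : fieldType).
Notation S := {mpoly R[n]}.
Implicit Types (I Q P T : S -> Prop) (fs : seq S).

(** An ideal maximal among those containing I and disjoint from the multiplicative set T is
    prime. *)
Lemma prime_avoiding I T : is_ideal I -> T 1 -> (forall a b, T a -> T b -> T (a * b)) ->
  (forall t, T t -> ~ I t) ->
  exists P, [/\ prime_ideal P, (forall p, I p -> P p) & (forall t, T t -> ~ P t)].
Proof.
move=> hI T1 TM IT.
pose good P := [/\ is_ideal P, (forall p, I p -> P p) & (forall t, T t -> ~ P t)].
have [|A [goodA maxA]] :=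
  @classical_sets.Zorn_bigcup S (fun A => good A \/ forall x, ~ A x).
  move=> F Fgood Ftot; case: (classic (exists2 A, F A & exists x, A x)); last first.
    by move=> h; right=> x [A FA Ax]; apply: h; exists A => //; exists x.
  move=> [A FA [x Ax]]; left.
  have [hA IA TA] : good A by case: (Fgood A FA) => // /(_ x).
  have gd B y : F B -> B y -> good B by move=> /Fgood[]// h /h.
  split.
  - split; first by exists A => //; apply: ideal0.
      move=> p q [B FB Bp] [C FC Cq].
      have [hB _ _] := gd B p FB Bp; have [hC _ _] := gd C q FC Cq.
      case: (Ftot B C FB FC) => sub; [exists C | exists B] => //; apply: idealD => //; exact: sub.
    move=> p q [B FB Bq]; have [hB _ _] := gd B q FB Bq.
    by exists B => //; apply: idealM.
  - by move=> p Ip; exists A => //; apply: IA.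
  - by move=> t Tt [B FB Bt]; have [_ _ TB] := gd B t FB Bt; exact: (TB t).
have {}maxA B : (forall x, A x -> B x) -> good B -> forall x, B x -> A x.
  move=> AB gB; apply: Classical_Prop.NNPP => nBA; apply: (maxA B); last by left.
  by split.
have {}goodA : good A.
  case: goodA => // empty.
  have /(_ 0) : forall x, I x -> A x by apply: maxA => // x /empty.
  by move=> /(_ (ideal0 hI)) /empty.
have [hA IA TA] := goodA.
have enlarge a : ~ A a -> exists t u, T t /\ A (t - u * a).
  move=> nA; apply: Classical_Prop.NNPP => nex; apply: nA.
  apply: (maxA (addI A a)).
  - by move=> x Ax; exists 0; rewrite mul0r subr0.
  - split; first exact: addI_is_ideal.
      by move=> p /IA Ap; exists 0; rewrite mul0r subr0.
    by move=> t Tt [u Au]; apply: nex; exists t, u.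
  - by exists 1; rewrite mul1r subrr; apply: ideal0.
exists A; split=> //; split=> //; first exact: TA.
move=> a b Aab; apply: Classical_Prop.NNPP => /Decidable.not_or[/enlarge[t [u [Tt At]]] /enlarge[s [v [Ts As]]]].
apply: (TA (t * s)); first exact: TM.
have -> : t * s = s * (t - u * a) + u * a * (s - v * b) + u * v * (a * b) by ring.
by apply: idealD; [|apply: idealD|]; try apply: idealM.
Qed.

(** For the last member g, the products s g^k with s outside Q avoid (fs), as g is a nonzerodivisor.
    A prime over fs avoiding them lies in Q and misses g, so Q extends its chain strictly. *)
Lemma height_ge_reg fs Q : wreg fs -> prime_ideal Q ->
  (forall i, (i < size fs)%N -> Q fs`_i) -> height_ge Q (size fs).
Proof.
elim/last_ind: fs Q => [|fs g IH] Q.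
  move=> _ pQ _; exists [:: Q]; split=> // i; by rewrite ltnS leqn0 => /eqP->.
move=> /wreg_rcons[wfs nz] pQ hQ; have [hQI nQ1 Qmul] := pQ.
have Qg : Q g by have := hQ (size fs); rewrite size_rcons nth_rcons ltnn eqxx; apply.
have Qfs i : (i < size fs)%N -> Q fs`_i.
  by move=> lt; have := hQ i; rewrite size_rcons nth_rcons lt; apply; apply: ltnW.
have [||||P [pP IP TP]] := @prime_avoiding (gen_ideal fs)
   (fun t => exists s k, ~ Q s /\ t = s * g ^+ k).
- exact: gen_is_ideal.
- by exists 1, 0%N; rewrite mulr1.
- move=> _ _ [s [k [ns ->]]] [t [l [nt ->]]]; exists (s * t), (k + l)%N.
  split; last by rewrite exprD mulrACA.
  by case/Qmul.
- move=> _ [s [k [ns ->]]] h; apply: ns; apply: (gen_sub hQI Qfs).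
  by elim: k h => [|k IHk]; rewrite ?mulr1 // exprSr mulrA => /nz.
have PQ p : P p -> Q p.
  move=> Pp; apply: Classical_Prop.NNPP => nq; apply: (TP p) => //.
  by exists p, 0%N; rewrite mulr1.
have nPg : ~ P g by apply: TP; exists 1, 1%N; rewrite mul1r.
have [|c [sc pc ic lc]] := IH P wfs pP; first by move=> i lt; apply/IP/gen_mem.
have nthE i : (i < (size fs).+1)%N -> nth Q (rcons c Q) i = nth P c i.
  by move=> lt; rewrite nth_rcons sc lt; apply: set_nth_default; rewrite sc.
have nthL : nth Q (rcons c Q) (size fs).+1 = Q by rewrite nth_rcons sc ltnn eqxx.
rewrite size_rcons; exists (rcons c Q); split.
- by rewrite size_rcons sc.
- move=> i; rewrite ltnS leq_eqVlt => /orP[/eqP->|lt]; first by rewrite nthL.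
  by rewrite nthE //; apply: pc.
- move=> i; rewrite ltnS leq_eqVlt => /orP[/eqP->|lt].
    rewrite nthL nthE // (_ : nth P c (size fs) = P); last first.
      by rewrite -[RHS]lc -nth_last sc.
    by split=> //; exists g.
  by rewrite !nthE; [apply: ic | exact: lt | exact: ltnW].
- by rewrite last_rcons.
Qed.

End Height.

(** * Lex monomials and the conclusion *)

Section LexMonomials.
Variables (R : fieldType) (ds : seq nat).
Hypotheses (dpos : forall d, d \in ds -> (0 < d)%N).
Local Notation h := (size ds).
Notation Sb := {mpoly R[h]}.
Local Notation dd i := (nth 0%N ds i).
Local Notation sg k := (sigma (take k ds)).

Lemma xd_gensE : xd_gens R ds =
  [seq 'X_[u] | u <- [seq (U_(i) *+ dd i)%MM | i <- enum 'I_h]].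
Proof. by rewrite -map_comp; apply: eq_map => i /=; rewrite mpolyXn. Qed.

Lemma xd_monomial (u : 'X_{1..h}) :
  gen_ideal (xd_gens R ds) 'X_[u] <-> exists i : 'I_h, (dd i <= u i)%N.
Proof.
rewrite xd_gensE mono_genP; split=> [h0|[i le] m].
  have [|v /mapP[i _ ->] /mnm_lepP/(_ i)] := h0 u; first by rewrite msuppX mem_head.
  by rewrite mulmnE mnm1E eqxx mul1n => le; exists i.
rewrite msuppX inE => /eqP->; exists (U_(i) *+ dd i)%MM.
  by apply/mapP; exists i; rewrite // mem_enum.
apply/mnm_lepP => j; rewrite mulmnE mnm1E; case: eqP => [<-|_] //.
by rewrite mul1n.
Qed.

Lemma std_monP E (u : 'X_{1..h}) : std_mon R E u <-> mdeg u = E /\ forall i, (u i < dd i)%N.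
Proof.
rewrite /std_mon xd_monomial; split=> -[uE hu]; split=> //.
  by move=> i; rewrite ltnNge; apply/negP => le; apply: hu; exists i.
by move=> [i]; rewrite leqNgt hu.
Qed.

(** Each variable in turn is filled up to d_i - 1 until degree E is used up; truncated subtraction
    makes the later exponents 0. *)
Definition greedy E : 'X_{1..h} := [multinom minn (dd i - 1) (E - sg i) | i < h].

Lemma sg_recr k : (k < h)%N -> sg k.+1 = (sg k + (dd k - 1))%N.
Proof.
by move=> lt; rewrite (take_nth 0%N lt) -cats1 sigma_cat [in X in (_ + X)%N]/sigma big_seq1.
Qed.

Lemma greedy_partial E k : (k <= h)%N ->
  (\sum_(i < h | (i < k)%N) greedy E i = minn (sg k) E)%N.
Proof.
elim: k => [|k IH] lt; first by rewrite big_pred0 // take0 /sigma big_nil min0n.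
rewrite (bigD1 (Ordinal lt)) //= (eq_bigl (fun i : 'I_h => (i < k)%N)); last first.
  by move=> i; rewrite -val_eqE /= ltnS ltn_neqAle andbC.
rewrite IH ?(ltnW lt) // mnmE sg_recr //=; lia.
Qed.

Lemma mdeg_greedy E : (E <= sigma ds)%N -> mdeg (greedy E) = E.
Proof.
move=> le; have pE := greedy_partial E (leqnn h); rewrite take_size (minn_idPr le) in pE.
rewrite mdegE -[RHS]pE.
by apply: eq_bigl => i; rewrite ltn_ord.
Qed.

Lemma first_difference (u v : 'X_{1..h}) : u <> v ->
  exists i : 'I_h, (forall k : 'I_h, (k < i)%N -> u k = v k) /\ u i != v i.
Proof.
move=> ne; have [i0 hi0] : exists i, u i != v i.
  apply/existsP; apply: contra_notT ne; rewrite negb_exists => /forallP e.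
  by apply/mnmP => i; apply/eqP; rewrite -[_ == _]negbK.
have [i nei mini] := @arg_minnP _ i0 (fun i => u i != v i) val hi0.
exists i; split=> // k; rewrite ltnNge => nle; apply/eqP; apply: contraNT nle => nek.
exact: mini.
Qed.

(** If v first differs from [greedy E] at i and is larger there, then [greedy E] has not saturated
    variable i, so it has spent all of E by then and v exceeds degree E. *)
Lemma greedy_is_UE E : (E <= sigma ds)%N -> is_UE R E (greedy E).
Proof.
move=> le; split.
  apply/std_monP; split=> [|i]; first exact: mdeg_greedy.
  rewrite mnmE; apply: leq_ltn_trans (geq_minl _ _) _.
  by rewrite subn1 ltn_predL; apply/dpos/mem_nth.
move=> v /std_monP[vE vd]; case: (classic (v = greedy E)) => [|ne]; first by left.
right; have [i [eqk nei]] := first_difference ne; exists i; split=> //.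
rewrite ltn_neqAle nei /= leqNgt; apply/negP => gt.
have lti := ltn_ord i.
have pE : (\sum_(k < h | (k < i)%N) v k = minn (sg i) E)%N.
  by rewrite -(greedy_partial E (ltnW lti)); apply: eq_bigr => k /eqk.
have : (\sum_(k < h | (k < i)%N) v k + v i <= E)%N.
  rewrite -vE mdegE [leqRHS](bigID (fun k : 'I_h => (k < i)%N)) /= leq_add2l.
  by rewrite (bigD1 i) /= ?ltnn // leq_addr.
rewrite pE; move: gt (vd i); rewrite mnmE.
move: (v i) (sg i) (dd i) => a b d; lia.
Qed.

Lemma lex_lt_asym (u v : 'X_{1..h}) : lex_lt u v -> lex_lt v u -> False.
Proof.
move=> [i [ei li]] [j [ej lj]]; case: (ltngtP i j) => [lt|lt|/val_inj E].
- by rewrite (ej i lt) ltnn in li.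
- by rewrite (ei j lt) ltnn in lj.
- by rewrite E in li; have := ltn_trans li lj; rewrite ltnn.
Qed.

(** The choice made by [epsilon] is pinned down by uniqueness of the lex-largest monomial. *)
Lemma U_E_greedy E : (E <= sigma ds)%N -> U_E R ds E = greedy E.
Proof.
move=> le; have gUE := greedy_is_UE le.
have [sU mU] : is_UE R E (U_E R ds E) by apply: epsilon_spec; exists (greedy E).
have [sg mg] := gUE.
case: (mU _ sg) => // lt1; case: (mg _ sU) => // lt2.
by case: (lex_lt_asym lt1 lt2).
Qed.

Lemma greedy_full E (i : 'I_h) : (sg i.+1 <= E)%N ->
  gen_ideal (xd_gens R ds) ('X_i * 'X_[greedy E]).
Proof.
move=> le; rewrite -mpolyXD; apply/xd_monomial; exists i.
rewrite mnmDE mnm1E eqxx mnmE; move: le; rewrite sg_recr // => le.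
have := dpos (mem_nth 0%N (ltn_ord i)); lia.
Qed.

Lemma linear_form_coefs (p : Sb) : p \is 1.-homog -> p = \sum_i p@_U_(i) *: 'X_i.
Proof.
move=> hp; apply/mpolyP => m; rewrite raddf_sum /=.
have [/eqP|ne] := eqVneq (mdeg m) 1%N; last first.
  rewrite (dhomog_nemf_coeff hp ne) big1 // => i _; rewrite mcoeffZ mcoeffX.
  by case: eqP => [E|_]; rewrite ?mulr0 //; rewrite -E mdeg1 in ne.
case/mdeg1P=> j /eqP->; rewrite (bigD1 j) //= mcoeffZ mcoeffX eqxx mulr1 big1 ?addr0 // => i ne.
by rewrite mcoeffZ mcoeffX eq_mnm1 (negbTE ne) mulr0.
Qed.

(** A saturated variable times the greedy monomial lies in the ideal of pure powers, so the
    unsaturated variables span in degree 1. *)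
Lemma colon_greedy_HF1 E :
  (HF (colon (gen_ideal (xd_gens R ds)) 'X_[greedy E]) 1 <= psi ds E)%N.
Proof.
have hJ := colon_is_ideal 'X_[greedy E] (gen_is_ideal (xd_gens R ds)).
pose A := [pred i : 'I_h | (E < sg i.+1)%N].
have -> : psi ds E = size [seq 'X_i : Sb | i <- enum A].
  rewrite size_map -cardE -sum1_card big_mkcond /psi; apply: eq_bigr => i _.
  by rewrite inE; case: ifP.
apply: HF_le_spans => // p hp.
exists (fun k => p@_(nth 0%MM [seq U_(i)%MM | i <- enum A] k)).
have -> : lincomb (fun k => p@_(nth 0%MM [seq U_(i)%MM | i <- enum A] k)) [seq 'X_i | i <- enum A]
    = \sum_(i in A) p@_U_(i) *: 'X_i.
  rewrite /lincomb size_map -[RHS]big_enum /=.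
  case: (enum A) => [|i0 s]; first by rewrite big_nil big_ord0.
  by rewrite (big_nth i0) big_mkord; apply: eq_bigr => k _; rewrite !(nth_map i0).
rewrite {1}(linear_form_coefs hp) (bigID (mem A)) /= addrAC subrr add0r.
apply: ideal_sum => // i; rewrite inE -leqNgt => le; apply: idealZ => //.
exact: greedy_full.
Qed.

(** By [HF_add], phi_m is the dimension in degree 1 of the quotient by the colon of the pure powers
    by U_(m-1). *)
Lemma phi_le_psi m : phi R ds m <= (psi ds m.-1)%:Z.
Proof.
rewrite /phi; case: ifP => // /andP[m2 mle].
have le : (m.-1 <= sigma ds)%N by lia.
rewrite /Lid U_E_greedy // HF_gen_rcons.
have hom : homog_ideal (gen_ideal (xd_gens R ds)).
  apply: gen_homog => i; rewrite size_map size_enum_ord => lti.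
  exists (dd i); rewrite (nth_map (Ordinal lti)) ?size_enum_ord //.
  rewrite (nth_ord_enum (Ordinal lti) (Ordinal lti)).
  by have := dhomogMn (dd i) (var_homog R (Ordinal lti)); rewrite mul1n.
have hg : ('X_[greedy m.-1] : Sb) \is m.-1.-homog.
  by rewrite dhomogX; apply/eqP/mdeg_greedy.
have mE : (1 + m.-1 = m)%N by lia.
have := HF_add 1 (gen_is_ideal _) hom hg; rewrite mE => ->.
by rewrite PoszD addrC addKr lez_nat colon_greedy_HF1.
Qed.

End LexMonomials.

(** * Growth and leading coefficients of rational polynomials *)

Section RationalPolynomials.
Implicit Types p q : {poly rat}.

(** A uniform positive lower bound, stronger than positivity, carries the induction: for p X + c the
    product j e eventually exceeds 1 + |c|. *)
Lemma pos_lead_coef p : 0 < lead_coef p ->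
  exists2 e : rat, 0 < e & exists N : nat, forall j : nat, (N <= j)%N -> e <= p.[j%:R].
Proof.
elim/poly_ind: p => [|p c IH]; first by rewrite lead_coef0 ltxx.
have [->|p0] := eqVneq p 0.
  rewrite mul0r add0r lead_coefC => c0; exists c => //; exists 0%N => j _.
  by rewrite hornerC.
rewrite lead_coefDl ?size_mulX ?size_polyC //; last first.
  by rewrite ltnS; case: (c != 0); rewrite // size_poly_gt0.
rewrite lead_coefMX => /IH[e e0 [N hN]].
exists 1 => //; exists (maxn N (Num.truncn ((1 + `|c|) / e)).+1) => j.
rewrite geq_max => /andP[/hN le lt]; rewrite hornerMXaddC.
have : (1 + `|c|) / e <= j%:R.
  apply: le_trans (_ : (Num.truncn ((1 + `|c|) / e)).+1%:R <= _); last by rewrite ler_nat.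
  by apply/ltW; apply: Num.Theory.truncnS_gt; rewrite divr_ge0 ?addr_ge0 // ltW.
rewrite ler_pdivrMr // => h.
have h2 : j%:R * e <= p.[j%:R] * j%:R by rewrite mulrC ler_wpM2r.
have := ler_norm (- c); rewrite normrN => h3.
have : 1 + `|c| <= p.[j%:R] * j%:R := le_trans h h2.
by rewrite -lerBlDr; apply: le_trans; rewrite lerD2l.
Qed.

Lemma eventually_nonneg_lead p j0 :
  (forall j : nat, (j0 <= j)%N -> 0 <= p.[j%:R]) -> 0 <= lead_coef p.
Proof.
move=> h; rewrite leNgt; apply/negP => lt.
have [|e e0 [N hN]] := @pos_lead_coef (- p); first by rewrite lead_coefN oppr_gt0.
have := hN (maxn j0 N) (leq_maxr _ _); rewrite hornerN leNgt => /negP; apply.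
apply: le_lt_trans e0; rewrite oppr_le0; apply: h; exact: leq_maxl.
Qed.

Lemma eventually_nonneg_coef p r j0 : (size p <= r.+1)%N ->
  (forall j : nat, (j0 <= j)%N -> 0 <= p.[j%:R]) -> 0 <= p`_r.
Proof.
rewrite leq_eqVlt => /orP[/eqP sp|lt] h; last by rewrite nth_default.
by have := eventually_nonneg_lead h; rewrite lead_coefE sp.
Qed.

(** The binomial coefficient C(X + r, r) as a polynomial in X. *)
Definition binpoly r : {poly rat} := (r`!%:R)^-1 *: \prod_(i < r) ('X + (i.+1%:R)%:P).

Lemma binpoly_lead r : size (binpoly r) = r.+1 /\ lead_coef (binpoly r) = (r`!%:R)^-1.
Proof.
have nz : (r`!%:R)^-1 != 0 :> rat by rewrite invr_eq0 pnatr_eq0 -lt0n fact_gt0.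
rewrite /binpoly size_scale // lead_coefZ.
have E : \prod_(i < r) ('X + (i.+1%:R)%:P) =
   \prod_(c <- [seq - i.+1%:R | i : 'I_r <- index_enum 'I_r]) ('X - c%:P) :> {poly rat}.
  by rewrite big_map; apply: eq_bigr => i _; rewrite polyCN opprK.
rewrite E size_prod_XsubC size_map (monicP (monic_prod_XsubC _ _ _)) mulr1.
by split=> //; rewrite /index_enum -enumT size_enum_ord.
Qed.

Lemma binpoly_horner r (j : nat) : (binpoly r).[j%:R] = 'C(j + r, r)%:R.
Proof.
have nz : r`!%:R != 0 :> rat by rewrite pnatr_eq0 -lt0n fact_gt0.
apply: (mulfI nz); rewrite /binpoly hornerZ mulrA divff // mul1r.
rewrite -natrM mulnC bin_ffact.
rewrite horner_prod {nz}; elim: r => [|r IH]; first by rewrite big_ord0 ffactn0.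
rewrite big_ord_recr /= IH hornerD hornerX hornerC addnS ffactSS -natrD -natrM.
by rewrite addnS mulnC.
Qed.

Definition binpoly_shift r c : {poly rat} := binpoly r \Po ('X - (c%:R)%:P).

Lemma binpoly_shift_lead r c :
  size (binpoly_shift r c) = r.+1 /\ lead_coef (binpoly_shift r c) = (r`!%:R)^-1.
Proof.
have [sb lb] := binpoly_lead r.
rewrite /binpoly_shift size_comp_poly2 ?size_XsubC // sb lead_coef_comp ?size_XsubC //.
by rewrite lb lead_coefXsubC expr1n mulr1.
Qed.

Lemma binpoly_shift_horner r (c j : nat) : (c <= j)%N ->
  (binpoly_shift r c).[j%:R] = 'C(j - c + r, r)%:R.
Proof. by move=> le; rewrite /binpoly_shift horner_comp hornerXsubC -natrB // binpoly_horner. Qed.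

Lemma multiplicity_bound (P : {poly rat}) r (A B c c' j0 : nat) :
  (forall j : nat, (j0 <= j)%N -> P.[j%:R] + (B * 'C(j - c + r, r))%:R <= (A * 'C(j + r, r))%:R) ->
  (forall j : nat, (j0 <= j)%N -> 'C(j - c' + r, r)%:R <= P.[j%:R]) ->
  mult_of_poly P <= A%:R - B%:R.
Proof.
move=> up lo.
have f0 : 0 < r`!%:R :> rat by rewrite ltr0n fact_gt0.
have [s0 l0] := binpoly_lead r; have [sc lc] := binpoly_shift_lead r c.
have [sc' lc'] := binpoly_shift_lead r c'.
pose L := P - binpoly_shift r c'.
pose M := A%:R *: binpoly r - B%:R *: binpoly_shift r c.
have Lpos : forall j : nat, (maxn j0 c' <= j)%N -> 0 <= L.[j%:R].
  move=> j; rewrite geq_max => /andP[h1 h2].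
  by rewrite hornerD hornerN binpoly_shift_horner // subr_ge0 lo.
have Upos : forall j : nat, (maxn j0 c <= j)%N -> 0 <= (M - P).[j%:R].
  move=> j; rewrite geq_max => /andP[h1 h2].
  rewrite hornerD hornerN /M hornerD hornerN.
  rewrite [(A%:R *: _).[_]]hornerZ [(B%:R *: _).[_]]hornerZ.
  rewrite binpoly_shift_horner // binpoly_horner -!natrM.
  by rewrite subr_ge0 lerBrDr up.
have sM : (size M <= r.+1)%N.
  apply: leq_trans (size_polyD _ _) _; rewrite size_polyN geq_max.
  by rewrite -{1}s0 -{1}sc !size_scale_leq.
have sP : size P = r.+1.
  (* Were the degree above r, both P and -P would have nonnegative leading coefficient; were it
     below r, P minus the shifted binomial would have a negative one. *)
  apply/eqP; rewrite eqn_leq; apply/andP; split; rewrite leqNgt; apply/negP => lt.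
    have := eventually_nonneg_lead Upos; rewrite addrC lead_coefDl ?size_polyN; last first.
      exact: leq_ltn_trans sM lt.
    have := eventually_nonneg_lead Lpos; rewrite /L lead_coefDl ?size_polyN ?sc' //.
    rewrite lead_coefN oppr_ge0 => h1 h2.
    have : lead_coef P == 0 by rewrite eq_le h1 h2.
    by rewrite lead_coef_eq0 -size_poly_eq0; case: (size P) lt.
  have := eventually_nonneg_lead Lpos; rewrite /L addrC lead_coefDl ?size_polyN ?sc' //.
  by rewrite lead_coefN lc' oppr_ge0 leNgt invr_gt0 f0.
have : 0 <= (M - P)`_r.
  apply: eventually_nonneg_coef Upos; apply: leq_trans (size_polyD _ _) _.
  by rewrite size_polyN geq_max sM sP leqnn.
rewrite coefB /M coefB (coefZ _ (binpoly r)) (coefZ _ (binpoly_shift r c)).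
have -> : (binpoly r)`_r = (r`!%:R)^-1 by rewrite -l0 lead_coefE s0.
have -> : (binpoly_shift r c)`_r = (r`!%:R)^-1 by rewrite -lc lead_coefE sc.
rewrite /mult_of_poly sP /= lead_coefE sP /= -mulrBl subr_ge0 => h.
by rewrite mulrC -ler_pdivlMr.
Qed.

End RationalPolynomials.

(** * Assembling the multiplicity estimate *)

Section Assembly.
Variables (n : nat) (R : fieldType).
Notation S := {mpoly R[n]}.
Variables (ds : seq nat) (fs : seq S) (G : S) (D : nat).
Hypothesis haci : aci ds D fs G.

Lemma aci_data : [/\ homs fs ds /\ wreg fs, sorted leq ds, ~ gen_ideal fs 1,
  G \is D.-homog & ~ gen_ideal fs G].
Proof. by case: haci => -[sE hfs wfs n1] srt hG nG _; split. Qed.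

Lemma aci_zero_divisor : exists u e, [/\ u \is e.-homog, ~ gen_ideal fs u & gen_ideal fs (u * G)].
Proof.
have [[hfs wfs] _ n1 hG nG] := aci_data.
case: haci => _ _ _ _ [_ [Q [pQ IQ nh]]].
have [p [pG np]] : exists p, gen_ideal fs (p * G) /\ ~ gen_ideal fs p.
  apply: Classical_Prop.NNPP => nex; apply: nh.
  have := @height_ge_reg _ _ (rcons fs G) Q; rewrite size_rcons hfs.1; apply=> //.
    apply/wreg_rcons; split=> // p pG; apply: Classical_Prop.NNPP => np.
    by apply: nex; exists p.
  by move=> i lti; apply: IQ; apply: gen_mem; rewrite size_rcons hfs.1.
have [e ne] := not_ideal_comp (gen_is_ideal fs) np.
exists (pihomog mdeg e p), e; split=> //; first exact: pihomogP.
by rewrite -(pihomogMr _ _ hG); apply: (homs_homog_ideal hfs).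
Qed.

Lemma cum_HF_add j : (D <= j)%N ->
  (\sum_(i < j.+1) HF (gen_ideal fs) i = \sum_(i < j.+1) HF (gen_ideal (rcons fs G)) i
     + \sum_(i < (j - D).+1) HF (colon (gen_ideal fs) G) i)%N.
Proof.
have [[hfs wfs] _ n1 hG nG] := aci_data; have hom := homs_homog_ideal hfs.
move=> /subnK<-; rewrite addnK; move: (j - D)%N => k.
have E i : HF (gen_ideal (rcons fs G)) i = HF (addI (gen_ideal fs) G) i by apply: HF_gen_rcons.
rewrite addnC -addnS !big_split_ord /= -addnA -big_split; congr (_ + _)%N; apply: eq_bigr => i _ /=.
  by rewrite E (HF_add_small _ hom hG).
by rewrite E addnC (HF_add i (gen_is_ideal fs) hom hG).
Qed.

(** The upper estimate subtracts the growth of S/(f : G) from that of S/f. The lower one takes u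
    outside f with u G in f: then f + (G) lies in (f : u), and S/(f : u) has cumulative growth of
    degree r. *)
Lemma aci_multiplicity_bound P : cum_hilbert_poly (gen_ideal (rcons fs G)) P ->
  mult_of_poly P <= (\prod_(d <- ds) d)%N%:R - (bound ds D)%:R.
Proof.
have [[hfs wfs] srt n1 hG nG] := aci_data.
have nE : n = (size fs + (n - size fs))%N by rewrite subnKC // (reg_size hfs).
set r := (n - size fs)%N in nE *.
have hfs0 : homs fs (ds ++ nseq 0 1%N) by rewrite cats0.
have [c hc] := colon_lower_bound srt hfs0 wfs nE hG nG (leqnn D).
have [u [e [hu nu uG]]] := aci_zero_divisor.
have [c' hc'] := colon_lower_bound srt hfs0 wfs nE hu nu (leqnn e).
move=> [j0 hP].
(* The shift is c + D because S/(f : G) enters the exact sequence shifted by D. *)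
apply: (@multiplicity_bound P r _ _ (c + D) c' (j0 + c + D + c')%N) => j lej.
  rewrite -hP -?natrD ?ler_nat; last by lia.
  apply: leq_trans (cum_HF_upper j hfs wfs n1).
  rewrite (@cum_HF_add j) ?leq_add2l; last by lia.
  have -> : (j - (c + D) = j - D - c)%N by lia.
  by apply: hc; lia.
rewrite -hP ?ler_nat; last by lia.
apply: (@leq_trans (\sum_(i < j.+1) HF (colon (gen_ideal fs) u) i)).
  apply: leq_trans (hc' j _); last by lia.
  by apply: leq_pmull; rewrite /bound; case: ifP.
apply: leq_sum => i _; apply: HF_mono => //; first exact: colon_is_ideal.
move=> p _ /gen_rcons[a h]; rewrite /colon.
apply: (ideal_eq (q := a * (u * G))) => //; last exact: idealM.
by rewrite (_ : _ - _ = u * (p - a * G)); [apply: idealM | ring].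
Qed.

End Assembly.

Theorem theorem3p5 (R : fieldType) (n : nat) (ds : seq nat)
    (fs : seq {mpoly R[n]}) (G : {mpoly R[n]}) (D : nat) :
  aci ds D fs G ->
  (D < sigma ds)%N ->
  let tau_m := ((sigma ds + D - 1) %/ 2)%N in
  let tau_p := ((sigma ds + D) %/ 2)%N in
  forall P : {poly rat},
    cum_hilbert_poly (gen_ideal (rcons fs G)) P ->
    mult_of_poly P <=
      (\prod_(d <- ds) d)%:R
      - (\sum_(D.+1 <= m < tau_m.+1) phi R ds m)%:~R
      - (\sum_(D.+1 <= m < tau_p.+1) phi R ds m)%:~R - 2.
Proof.
move=> haci lt tau_m tau_p P hP.
have [[hfs wfs] _ n1 _ _] := aci_data haci.
apply: le_trans (aci_multiplicity_bound haci hP) _.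
have dpos := reg_degree_pos hfs wfs n1.
have hphi t : (\sum_(D.+1 <= m < t) phi R ds m)%:~R <=
    (\sum_(D.+1 <= m < t) psi ds m.-1)%N%:R :> rat.
  rewrite -[leRHS]mulrz_nat ler_int natr_sum; apply: ler_sum => m _.
  by rewrite natz; apply: phi_le_psi.
have h1 := hphi tau_m.+1; have h2 := hphi tau_p.+1.
(* D < sigma selects the first branch of [bound], whose summation limits are [tau_m] and [tau_p]. *)
by rewrite /bound lt -/tau_m -/tau_p !natrD; lra.
Qed.
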